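(* Let $\lambda$ be a partition, let $k$ be the $(m,n)$-index of $\lambda$, and let $0 \leq l \leq \min\{n-k, n\}$. Let $\mathcal{S}$, $\mathcal{T}$ and $\mathcal{Y}$ be sets containing $l$, $n-l$ and $m$ variables, respectively, so that $\Delta(\mathcal{Y}) \neq 0$ and $\Delta(\mathcal{S};\mathcal{T}) \neq 0$. Then $$LS_\lambda(-(\mathcal{S}\cup\mathcal{T});\mathcal{Y}) = \sum_{p=0}^{\min\{l,m\}} \ \sum_{\mathcal{U},\mathcal{V}} \ \sum_{\mu,\nu} \frac{\Delta(\mathcal{V};\mathcal{S})\Delta(\mathcal{T};\mathcal{U})}{\Delta(\mathcal{V};\mathcal{U})\Delta(\mathcal{T};\mathcal{S})}\, \varepsilon(\mu,\nu)\, LS_{\mu - \langle (m-k)^{l-p}\rangle}(-\mathcal{S};\mathcal{U})\, LS_{\nu\cup\lambda_{(n+1-k,n+2-k,\dots)}}(-\mathcal{T};\mathcal{V}),$$ where the second sum is over all pairs of subsequences $\mathcal{U},\mathcal{V}\subset\mathcal{Y}$ of lengths $p$ and $m-p$, respectively, such that $\mathcal{U}\cup\mathcal{V}$ equals $\mathcal{Y}$ up to reordering, the third sum is over all pairs of partitions $\mu,\nu$ with $\mu\star_{l-p,\,n-k-l+p}\nu = \lambda_{[n-k]} = (\lambda_1,\dots,\lambda_{n-k})$, and $\varepsilon(\mu,\nu) = \varepsilon_{l-p,\,n-k-l+p}(\mu,\nu)$.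
   Context: Sequences are finite. Sets of variables are viewed as sequences (of elements of a field, e.g. indeterminates or complex numbers) in a fixed order; repetitions are allowed unless excluded. The union $\mathcal{A} \cup \mathcal{B}$ of two sequences is obtained by appending $\mathcal{B}$ to $\mathcal{A}$; sums, differences and negation of sequences are elementwise. $\Delta(\mathcal{X}) = \prod_{i<j} (\mathcal{X}_i - \mathcal{X}_j)$ and $\Delta(\mathcal{X};\mathcal{Y}) = \prod_{x \in \mathcal{X}, y \in \mathcal{Y}} (x-y)$. A partition is a non-increasing sequence of non-negative integers; partitions differing only by trailing zeros are equal; its length $l(\lambda)$ is the number of positive parts. When a partition is used as a sequence of prescribed length it is padded with zeros (here $\mu$ has length exactly $l-p$ and $\nu$ has length exactly $n-k-l+p$). $\langle a^b \rangle = (a,\dots,a)$ ($b$ entries). $\lambda_{(n+1-k, n+2-k,\dots)} = (\lambda_{n+1-k}, \lambda_{n+2-k}, \dots)$. $\lambda'$ is the conjugate partition. The Ferrers diagram of $\lambda$ is the set of points $(i,j)$ with $j \ge 1$, $1 \leq i \leq \lambda_j$; by convention also $(i,0) \in \lambda$ and $(0,i) \in \lambda$ for all non-negative integers $i$. Index: the $(m,n)$-index of $\lambda$ is the largest (possibly negative) integer $k \leq \min\{m,n\}$ with $(m+1-k, n+1-k) \notin \lambda$. Schur functions: for $\mathcal{X}$ of length $n$, $\mathfrak{s}_\lambda(\mathcal{X}) = 0$ if $l(\lambda) > n$, and otherwise $\mathfrak{s}_\lambda(\mathcal{X}) = \det(x^{\lambda_j+n-j})_{x \in \mathcal{X}, 1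 \le j \le n}/\Delta(\mathcal{X})$ (extended as a polynomial to repeated variables). Littlewood-Schur functions: $LS_\lambda(\mathcal{X};\mathcal{Y}) = \sum_{\mu,\nu} c^{\lambda}_{\mu\nu} \mathfrak{s}_\mu(\mathcal{X}) \mathfrak{s}_{\nu'}(\mathcal{Y})$ with $c^\lambda_{\mu\nu}$ the Littlewood-Richardson coefficients. Overlap: $\rho_n = (n-1,\dots,1,0)$ ($\rho_0$ is empty). For partitions $\mu,\nu$ of length at most $a$ and $b$, respectively, the $(a,b)$-overlap $\mu \star_{a,b} \nu$ is the partition (of length at most $a+b$) such that $\mu \star_{a,b}\nu + \rho_{a+b}$ equals $(\mu+\rho_a) \cup (\nu+\rho_b)$ up to reordering, if it exists; otherwise $\mu \star_{a,b}\nu = \infty$, a symbol that is not a partition. If the overlap is a partition, $\varepsilon_{a,b}(\mu,\nu)$ is the sign of the permutation sorting $(\mu+\rho_a)\cup(\nu+\rho_b)$ into the strictly decreasing sequence $\mu\star_{a,b}\nu+\rho_{a+b}$; otherwise $\varepsilon_{a,b}(\mu,\nu)=1$. *)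

(* Defs.v *)
From mathcomp Require Import all_boot all_order all_fingroup all_algebra.
From mathcomp Require Import mpoly.
From mathcomp Require Import zify.

Set Implicit Arguments.
Unset Strict Implicit.
Unset Printing Implicit Defensive.

Import Order.TTheory GRing.Theory Num.Theory.

Local Open Scope ring_scope.

(* A partition is a non-increasing [seq nat]; trailing zeros are allowed, and
   every definition below depends only on the function [nth 0 la]. *)
Definition is_part (la : seq nat) : bool := sorted geq la.

Definition part_length (la : seq nat) : nat := count (fun x => 0 < x)%N la.

Definition conj_part (la : seq nat) : seq nat :=
  mkseq (fun i => count (fun x => i < x)%N la) (head 0%N la).

(* Parts are numbered from 1 on paper, hence [j.-1]. *)
Definition in_ferrers (la : seq nat) (i j : int) : bool :=
  match i, j with
  | Posz i, Posz j => [|| i == 0, j == 0 | i <= nth 0 la j.-1]%N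
  | _, _ => false
  end.

Definition is_index (m n : nat) (la : seq nat) (k : int) : Prop :=
  let admissible (h : int) :=
    (h <= Num.min m%:Z n%:Z) /\ ~~ in_ferrers la (m%:Z + 1 - h) (n%:Z + 1 - h) in
  admissible k /\ forall h : int, admissible h -> h <= k.

Definition delta (R : nzRingType) (X : seq R) : R :=
  \prod_(i < size X) \prod_(j < size X | (i < j)%N) (X`_i - X`_j).

Definition delta2 (R : nzRingType) (X Y : seq R) : R :=
  \prod_(x <- X) \prod_(y <- Y) (x - y).

(* Weakly decreasing sequences of length [a] bounded by [b] are handled as
   elements of the finite type [a.-tuple 'I_b.+1]. *)
Definition vals (a b : nat) (t : a.-tuple 'I_b) : seq nat := [seq val i | i <- t].

Section SchurPolynomial.

Variable n : nat.

Definition rho_exp (la : seq nat) (j : 'I_n) : nat := (nth 0 la j + (n - j.+1))%N.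

Definition alternant (al : 'I_n -> nat) : {mpoly int[n]} :=
  \det (\matrix_(i, j) 'X_i ^+ al j).

Definition vandermonde : {mpoly int[n]} :=
  \prod_(i < n) \prod_(j < n | (i < j)%N) ('X_i - 'X_j).

Lemma newton_interpolation (R : comNzRingType) (N : nat) :
  forall (x : nat -> R) (f : {poly R}), exists c : nat -> R,
  forall i, (i < N)%N -> f.[x i] =
    \sum_(k < N) c k * \prod_(0 <= t < k) (x i - x t).
Proof.
elim: N => [|N IH] x f; first by exists (fun=> 0).
have /factor_theorem[q Eq] : root (f - f.[x 0%N]%:P) (x 0%N).
  by rewrite /root !hornerE subrr.
have {}Eq : f = q * ('X - (x 0%N)%:P) + f.[x 0%N]%:P by rewrite -Eq subrK.
have [c Hc] := IH (fun i => x i.+1) q.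
exists (fun k => if k is k'.+1 then c k' else f.[x 0%N]) => i lti.
rewrite big_ord_recl /= big_geq // mulr1.
rewrite {1}Eq !hornerE addrC; congr (_ + _).
case: i lti => [|i] lti.
  rewrite subrr mulr0 big1 // => k _.
  by rewrite /bump /= add1n big_nat_recl // subrr mul0r mulr0.
rewrite Hc // mulr_suml; apply: eq_bigr => k _.
by rewrite /bump /= add1n big_nat_recl // -mulrA; congr (_ * _); rewrite mulrC.
Qed.

Lemma vandermonde_swap :
  \prod_(i < n) \prod_(t < n | (t < i)%N) ('X_i - 'X_t : {mpoly int[n]}) =
  (\prod_(i < n) \prod_(j < n | (i < j)%N) (-1)) * vandermonde.
Proof.
rewrite /vandermonde -big_split /=.
under [RHS]eq_bigr do rewrite -big_split /=.
rewrite (exchange_big_dep predT) //=; apply: eq_bigr => i _.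
by apply: eq_bigr => j _; rewrite mulN1r opprB.
Qed.

Lemma alternant_divisible (al : 'I_n -> nat) :
  exists q : {mpoly int[n]}, q * vandermonde == alternant al.
Proof.
pose x (i : nat) : {mpoly int[n]} :=
  if insub i is Some j then 'X_j else 0.
have xE (i : 'I_n) : x i = 'X_i by rewrite /x valK.
have ex (j : 'I_n) : exists c : {ffun 'I_n -> {mpoly int[n]}}, forall i : 'I_n,
   'X_i ^+ al j == \sum_(k < n) c k * \prod_(t < n | (t < k)%N) ('X_i - 'X_t).
  have [c Hc] := newton_interpolation n x ('X ^+ al j).
  exists [ffun k : 'I_n => c k] => i; apply/eqP.
  have := Hc i (ltn_ord i); rewrite hornerXn xE => ->.
  apply: eq_bigr => k _; rewrite ffunE; congr (_ * _).
  rewrite big_mkord (big_ord_widen _ (fun t => 'X_i - x t) (ltnW (ltn_ord k))).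
  by apply: eq_bigr => t _; rewrite xE.
have {}ex (j : 'I_n) : exists c : {ffun 'I_n -> {mpoly int[n]}}, [forall i : 'I_n,
   'X_i ^+ al j == \sum_(k < n) c k * \prod_(t < n | (t < k)%N) ('X_i - 'X_t)].
  by have [c Hc] := ex j; exists c; apply/forallP.
pose C := \matrix_(k, j) xchoose (ex j) k.
pose N : 'M[{mpoly int[n]}]_n :=
  \matrix_(i, k) \prod_(t < n | (t < k)%N) ('X_i - 'X_t).
have MNC : \matrix_(i, j) 'X_i ^+ al j = N *m C.
  apply/matrixP => i j; rewrite !mxE.
  have /forallP/(_ i)/eqP -> := xchooseP (ex j).
  by apply: eq_bigr => k _; rewrite !mxE mulrC.
have trN : is_trig_mx N.
  apply/is_trig_mxP => i j ltij; rewrite mxE (bigD1 i) //= subrr mul0r //.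
exists (\det C * \prod_(i < n) \prod_(j < n | (i < j)%N) (-1)); apply/eqP.
rewrite /alternant MNC det_mulmx det_trig // -mulrA -vandermonde_swap mulrC.
by congr (_ * _); apply: eq_bigr => i _; rewrite mxE.
Qed.

(* The quotient of alternants, as a polynomial with integer coefficients. *)
Definition schur_poly (la : seq nat) : {mpoly int[n]} :=
  if (part_length la <= n)%N then xchoose (alternant_divisible (rho_exp la))
  else 0.

Lemma schur_polyE (la : seq nat) : (part_length la <= n)%N ->
  schur_poly la * vandermonde = alternant (rho_exp la).
Proof.
move=> le; rewrite /schur_poly le; exact/eqP/(xchooseP (alternant_divisible _)).
Qed.

End SchurPolynomial.

Definition schur (F : fieldType) (la : seq nat) (X : seq F) : F :=
  mmap intr (fun i : 'I_(size X) => X`_i) (schur_poly (size X) la).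

Lemma schurE (F : fieldType) (la : seq nat) (X : seq F) :
  (part_length la <= size X)%N -> delta X != 0 ->
  schur la X =
  \det (\matrix_(i < size X, j < size X) X`_i ^+ (nth 0%N la j + (size X - j.+1)))
    / delta X.
Proof.
move=> le nz; apply: (canRL (mulfK nz)).
pose f : {rmorphism {mpoly int[size X]} -> F} :=
  mmap intr (fun i : 'I_(size X) => X`_i).
have fX i : f 'X_i = X`_i by rewrite /f /= mmapX mmap1U.
have -> : delta X = f (vandermonde (size X)).
  rewrite /vandermonde rmorph_prod; apply: eq_bigr => i _.
  rewrite rmorph_prod; apply: eq_bigr => j _.
  by rewrite rmorphB !fX.
rewrite -[schur la X]/(f _) -rmorphM schur_polyE // /alternant -det_map_mx.
by congr (\det _); apply/matrixP => i j; rewrite !mxE rmorphXn /= fX.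
Qed.

Section LittlewoodRichardson.

Lemma alternant_perm n (s : 'S_n) (al : 'I_n -> nat) :
  alternant (fun i => al (s i)) = (-1) ^+ s * alternant al.
Proof.
rewrite /alternant.
have -> : \matrix_(i, j) 'X_i ^+ al (s j) =
  col_perm s (\matrix_(i, j) 'X_i ^+ al j) :> 'M[{mpoly int[n]}]_n.
  by apply/matrixP => i j; rewrite !mxE.
by rewrite col_permE det_mulmx det_perm odd_permV mulrC.
Qed.

Lemma alternant_noninj n (al : 'I_n -> nat) (i j : 'I_n) :
  i != j -> al i = al j -> alternant al = 0.
Proof.
move=> nij Eij; rewrite /alternant -det_tr.
by apply: (determinant_alternate nij) => r; rewrite !mxE Eij.
Qed.

Lemma alternantE n (al : 'I_n -> nat) :
  alternant al = \sum_(s : 'S_n) (-1) ^+ s *: 'X_[[multinom al (s i) | i < n]].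
Proof.
apply: eq_bigr => s _.
rewrite scaler_sign mulr_sign mpolyXE_id.
suff -> : \prod_(i < n) (\matrix_(i, j) 'X_i ^+ al j) i (s i) =
  \prod_(i < n) 'X_i ^+ [multinom al (s i) | i < n] i :> {mpoly int[n]} by [].
by apply: eq_bigr => i _; rewrite mxE mnmE.
Qed.

Lemma msym_alternant n (s : 'S_n) (al : 'I_n -> nat) :
  msym s (alternant al) = (-1) ^+ s * alternant al.
Proof.
rewrite /alternant -det_map_mx.
have -> : map_mx (msym s) (\matrix_(i, j) 'X_i ^+ al j) =
  row_perm s (\matrix_(i, j) 'X_i ^+ al j) :> 'M[{mpoly int[n]}]_n.
  by apply/matrixP => i j; rewrite !mxE rmorphXn /= /msym mmapX mmap1U.
by rewrite row_permE det_mulmx det_perm.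
Qed.

Lemma vandermonde_neq0 n : vandermonde n != 0.
Proof.
apply/prodf_neq0 => i _; apply/prodf_neq0 => j ltij.
apply/eqP => /(congr1 (fun p => p@_(U_(i))%MM)).
rewrite mcoeffB !mcoeffXU mcoeff0 eqxx.
by have -> : (j == i) = false by apply/eqP => E; rewrite E ltnn in ltij.
Qed.

Lemma vandermonde_alternant n : exists2 e : int,
  e * e = 1 & vandermonde n = e%:MP * alternant (fun j : 'I_n => j : nat).
Proof.
pose e : int := \prod_(i < n) \prod_(j < n | (i < j)%N) (-1).
have ee : e * e = 1.
  by rewrite /e -big_split big1 //= => i _; rewrite -big_split big1.
exists e => //.
have -> : alternant (fun j : 'I_n => j : nat) =
    \det (Vandermonde n (\row_i ('X_i : {mpoly int[n]}))).
  rewrite /alternant -det_tr; congr (\det _).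
  by apply/matrixP => i j; rewrite !mxE.
rewrite det_Vandermonde.
have -> : \prod_(i < n) \prod_(j < n | (i < j)%N)
    ((\row_i0 'X_i0) 0 j - (\row_i0 'X_i0) 0 i) = e%:MP * vandermonde n.
  rewrite /e /vandermonde rmorph_prod -big_split; apply: eq_bigr => i _ /=.
  rewrite rmorph_prod -big_split; apply: eq_bigr => j _ /=.
  by rewrite !mxE rmorphN rmorph1 mulN1r opprB.
by rewrite mulrA -rmorphM ee rmorph1 mul1r.
Qed.

Lemma msym_vandermonde n (s : 'S_n) :
  msym s (vandermonde n) = (-1) ^+ s * vandermonde n.
Proof.
have [e _ ->] := vandermonde_alternant n.
by rewrite rmorphM /= msym_alternant /msym mmapC mulrCA.
Qed.

Lemma schur_poly_sym n la : schur_poly n la \is symmetric.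
Proof.
case le: (part_length la <= n)%N; last by rewrite /schur_poly le rpred0.
apply/issymP => s.
have nz : (-1) ^+ s * vandermonde n != 0.
  by rewrite mulf_neq0 ?vandermonde_neq0 // signr_eq0.
apply: (mulIf nz); rewrite -msym_vandermonde -rmorphM schur_polyE //=.
by rewrite msym_alternant -schur_polyE // mulrCA msym_vandermonde.
Qed.

Lemma alternant_homog n (al : 'I_n -> nat) :
  alternant al \is (\sum_i al i)%N.-homog.
Proof.
rewrite alternantE; apply: rpred_sum => s _; apply: rpredZ.
rewrite dhomogX /= mdegE; apply/eqP.
rewrite [RHS](reindex_inj (@perm_inj _ s)) /=.
by apply: eq_bigr => i _; rewrite mnmE.
Qed.

Lemma vandermonde_homog n : vandermonde n \is (\sum_(i < n) i)%N.-homog.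
Proof.
have [e _ ->] := vandermonde_alternant n.
by rewrite mul_mpolyC; apply: rpredZ; apply: alternant_homog.
Qed.

Lemma homog_cofactor n (s v : {mpoly int[n]}) (d e : nat) :
  v != 0 -> v \is e.-homog -> s * v \is (d + e)%N.-homog -> s \is d.-homog.
Proof.
move=> nz hv hsv; rewrite homog_piE; apply/eqP/(mulIf nz).
pose K := (msize s + d.+1)%N.
have Es : s = \sum_(i < K) pihomog mdeg i s.
  by apply: pihomog_partitionE; rewrite leq_addr.
have Esv : s * v = \sum_(i < K) pihomog mdeg i s * v.
  by rewrite {1}Es big_distrl.
rewrite -[RHS](pihomog_dE hsv) Esv linear_sum /=.
have ltd : (d < K)%N by rewrite /K; lia.
rewrite (bigD1 (Ordinal ltd)) //= big1 ?addr0.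
  by rewrite [RHS]pihomog_dE //; apply: dhomogM => //; apply: pihomogP.
move=> i ni; apply: (@pihomog_ne0 _ _ _ (i + e)%N).
  by apply: contraNneq ni => E; apply/eqP/val_inj => /=; lia.
by apply: dhomogM => //; apply: pihomogP.
Qed.

Lemma sum_rho n : (\sum_(i < n) (n - i.+1) = \sum_(i < n) i)%N.
Proof. by rewrite [RHS](reindex_inj rev_ord_inj). Qed.

Lemma nth_sumn_le (mu : seq nat) (n : nat) :
  (n >= size mu)%N -> (\sum_(i < n) nth 0 mu i = sumn mu)%N.
Proof.
elim: mu n => [|x mu IH] n; first by rewrite big1 // => i _; rewrite nth_nil.
case: n => // n le; rewrite big_ord_recl /=; congr (_ + _)%N; exact: IH.
Qed.

Lemma part_length_nth mu i : is_part mu -> (part_length mu <= i)%N -> nth 0%N mu i = 0%N.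
Proof.
rewrite /is_part; elim: mu i => [|x mu IH] i; first by rewrite nth_nil.
rewrite /part_length /= (path_sortedE (rev_trans leq_trans)) => /andP[ax so].
case: i => [|i] /=; first by case: x ax => //= x _; rewrite add1n.
case: x ax => [|x] ax; last by rewrite add1n ltnS; apply: IH.
move=> _; case: (ltnP i (size mu)) => [lt|ge]; last by rewrite nth_default.
by have /allP/(_ _ (mem_nth 0%N lt)) := ax; rewrite /geq /= leqn0 => /eqP.
Qed.

Lemma sum_nth_part mu n : is_part mu -> (part_length mu <= n)%N ->
  (\sum_(i < n) nth 0 mu i = sumn mu)%N.
Proof.
move=> pm le; pose N := maxn n (size mu).
rewrite -(@nth_sumn_le mu N) ?leq_maxr //.
rewrite (big_ord_widen N (fun i => nth 0%N mu i)) ?leq_maxl //.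
rewrite big_mkcond; apply: eq_bigr => i _.
by case: ltnP => // ge; rewrite part_length_nth // (leq_trans le).
Qed.

Lemma part_length_sumn mu : (part_length mu <= sumn mu)%N.
Proof.
elim: mu => //= x mu; rewrite /part_length /= => le; case: x => //= x; lia.
Qed.

Lemma sum_rho_exp mu n : is_part mu -> (part_length mu <= n)%N ->
  (\sum_(i < n) rho_exp mu i = sumn mu + \sum_(i < n) i)%N.
Proof. by move=> pm le; rewrite big_split /= sum_rho sum_nth_part. Qed.

Lemma schur_poly_homog n la : is_part la -> (part_length la <= n)%N ->
  schur_poly n la \is (sumn la).-homog.
Proof.
move=> pl le; apply: (homog_cofactor (vandermonde_neq0 n) (vandermonde_homog n)).
by rewrite schur_polyE // -sum_rho_exp // alternant_homog.
Qed.

Lemma alternant_mul_sym n (al : 'I_n -> nat) (f : {mpoly int[n]}) :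
  f \is symmetric ->
  alternant al * f =
  \sum_(m <- msupp f) f@_m *: alternant (fun i => (al i + m i)%N).
Proof.
move=> /issymP sf.
transitivity (\sum_(s : 'S_n) \sum_(m <- msupp f) f@_m *:
   ((-1) ^+ s *: ('X_[[multinom (al (s i) + m (s i))%N | i < n]] : {mpoly int[n]}))).
  rewrite alternantE mulr_suml; apply: eq_bigr => s _.
  rewrite -[in LHS](sf (s^-1)%g) {1}[f]mpolyE raddf_sum mulr_sumr /=.
  apply: eq_bigr => m _.
  rewrite msymZ msymX invgK -scalerAl -scalerAr -mpolyXD scalerA mulrC -scalerA.
  by congr (_ *: (_ *: 'X_[_])); apply/mnmP => i; rewrite mnmDE !mnmE.
rewrite exchange_big; apply: eq_bigr => m _ /=.
by rewrite alternantE scaler_sumr.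
Qed.

Definition schur_span N (P : {mpoly int[N]}) : Prop :=
  exists c : {ffun N.-tuple 'I_N.+1 -> int},
    P = \sum_(la : N.-tuple 'I_N.+1 | is_part (vals la) && (sumn (vals la) == N))
          c la *: schur_poly N (vals la).

Lemma schur_span_lin N (a : int) (P Q : {mpoly int[N]}) :
  schur_span P -> schur_span Q -> schur_span (a *: P + Q).
Proof.
move=> [c ->] [d ->]; exists [ffun la => a * c la + d la].
rewrite scaler_sumr -big_split; apply: eq_bigr => la _ /=.
by rewrite ffunE scalerDl scalerA.
Qed.

Lemma schur_span0 N : schur_span (0 : {mpoly int[N]}).
Proof. by exists [ffun=> 0]; rewrite big1 // => la _; rewrite ffunE scale0r. Qed.

Lemma gtn_sorted_lb (w : seq nat) i :
  sorted gtn w -> (i < size w)%N -> (size w - i.+1 <= nth 0 w i)%N.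
Proof.
elim: w i => //= x w IH i px.
have so := path_sorted px.
case: i => [_|i lti]; last by have := IH i so lti; rewrite subSS.
case: w px so IH => //= y w /andP[xy _] so IH.
have := IH 0%N so isT; rewrite /= in xy *; lia.
Qed.

Lemma nth_vals a b (t : a.-tuple 'I_b) (i : 'I_a) : nth 0%N (vals t) i = tnth t i.
Proof.
have b0 : 'I_b by exact: (tnth t i).
by rewrite /vals (nth_map b0) ?size_tuple // (tnth_nth b0).
Qed.

Lemma alternant_span N (be : 'I_N -> nat) :
  (\sum_i be i = N + \sum_(i < N) i)%N ->
  exists2 P, schur_span P & P * vandermonde N = alternant be.
Proof.
move=> Ebe; case: (boolP (injectiveb be)) => [/injectiveP inj|/injectivePn]; last first.
  move=> [i [j nij Eij]]; exists 0; first exact: schur_span0.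
  by rewrite mul0r (alternant_noninj nij).
pose t := [tuple be i | i < N].
have ut : uniq t by rewrite map_inj_uniq ?enum_uniq.
have szt : size (sort geq t) == N by rewrite size_sort size_tuple.
have : perm_eq (sort geq t) t by rewrite perm_sort.
rewrite -[sort geq t]/(val (Tuple szt)) => /tuple_permP[s Es].
have ws : sorted gtn (sort geq t).
  have us : uniq (sort geq t) by rewrite sort_uniq.
  have so : sorted geq (sort geq t) by apply: sort_sorted => x y; exact: leq_total.
  apply/(sortedP 0%N) => i lti; have /(sortedP 0%N)/(_ i lti) := so.
  have := nth_uniq 0%N (ltnW lti) lti us.
  rewrite /geq /= ltn_neqAle => E ->; rewrite andbT eq_sym E; lia.
pose w := sort geq t.
have szw : size w = N by rewrite size_sort size_tuple.
have wE (i : 'I_N) : nth 0%N w i = be (s i).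
  rewrite -[w]/(val (Tuple szt)). rewrite Es.
  by rewrite (nth_map i) ?size_enum_ord // nth_ord_enum tnth_mktuple.
pose la := mkseq (fun i => (nth 0 w i - (N - i.+1))%N) N.
have lb i : (i < N)%N -> (N - i.+1 <= nth 0 w i)%N.
  by move=> lti; rewrite -{1}szw; apply: gtn_sorted_lb; rewrite ?szw.
have szla : size la = N by rewrite size_mkseq.
have rhoE : rho_exp (n := N) la =1 fun i => be (s i).
  by move=> i; rewrite /rho_exp nth_mkseq // subnK ?lb ?wE //.
have pla : is_part la.
  apply/(sortedP 0%N) => i; rewrite szla => lti.
  rewrite !nth_mkseq //; last exact: ltnW.
  have := lb _ lti; have := lb _ (ltnW lti).
  have /(sortedP 0%N)/(_ i) := ws; rewrite -/w szw => /(_ lti) /=; rewrite /geq /=; lia.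
have lela : (part_length la <= N)%N by rewrite -[X in (_ <= X)%N]szla count_size.
have suml : sumn la = N.
  have := sum_rho_exp pla lela; rewrite (eq_bigr _ (fun i _ => rhoE i)).
  have <- : (\sum_i be i = \sum_(i < N) be (s i))%N by exact: (reindex_inj (@perm_inj _ s)).
  by rewrite Ebe => /eqP; rewrite eqn_add2r => /eqP.
have bnd i : (nth 0 la i < N.+1)%N.
  rewrite ltnS; case: (ltnP i (size la)) => [lti|ge]; last by rewrite nth_default.
  rewrite -[X in (_ <= X)%N]suml; elim: (la) i lti => //= x l IH [|i] lti /=.
    exact: leq_addr.
  by apply: leq_trans (IH _ lti) _; apply: leq_addl.
pose tla : N.-tuple 'I_N.+1 := [tuple inord (nth 0%N la i) | i < N].
have vla : vals tla = la.
  apply: (@eq_from_nth _ 0%N); first by rewrite size_map size_tuple szla.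
  move=> i; rewrite size_map size_tuple => lti.
  by rewrite (nth_vals tla (Ordinal lti)) tnth_mktuple inordK.
exists ((-1) ^+ s *: schur_poly N la).
  exists [ffun x => if x == tla then (-1) ^+ s else 0].
  rewrite (bigD1 tla) /= ?vla ?pla ?suml ?eqxx // ffunE eqxx big1 ?addr0 //.
  by move=> i /andP[_ /negbTE ni]; rewrite ffunE ni scale0r.
rewrite -scalerAl schur_polyE //.
have -> : alternant (rho_exp (n := N) la) = alternant (fun i => be (s i)).
  by congr (\det _); apply/matrixP => i j; rewrite !mxE rhoE.
rewrite alternant_perm scaler_sign mulr_sign.
by case: (odd_perm s); rewrite ?opprK.
Qed.

(* Expansion of a product of Schur polynomials, in sufficiently many variables
   for all Schur polynomials of its degree to be linearly independent. *)
Lemma lr_expansion (mu nu : seq nat) :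
  let N := (sumn mu + sumn nu)%N in
  exists c : {ffun N.-tuple 'I_N.+1 -> int},
    is_part mu && is_part nu ==>
    (schur_poly N mu * schur_poly N nu ==
     \sum_(la : N.-tuple 'I_N.+1 | is_part (vals la) && (sumn (vals la) == N))
       c la *: schur_poly N (vals la)).
Proof.
move=> N; case: (boolP (is_part mu && is_part nu)) => [/andP[pm pn]|_]; last first.
  by exists [ffun=> 0].
suff [c Ec] : schur_span (schur_poly N mu * schur_poly N nu).
  by exists c; rewrite /= Ec.
have lm : (part_length mu <= N)%N.
  by rewrite (leq_trans (part_length_sumn _)) ?leq_addr.
have ln : (part_length nu <= N)%N.
  by rewrite (leq_trans (part_length_sumn _)) ?leq_addl.
set f := schur_poly N nu.
have hf : f \is (sumn nu).-homog by apply: schur_poly_homog.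
have := alternant_mul_sym (rho_exp (n := N) mu) (schur_poly_sym N nu).
rewrite -/f -schur_polyE //.
have {hf} : forall m, m \in msupp f -> mdeg m = sumn nu by move/dhomogP: hf.
move: (msupp f) => ms hms E.
suff [P spP EP] : exists2 P, schur_span P & P * vandermonde N =
    \sum_(m <- ms) f@_m *: alternant (fun i => (rho_exp (n := N) mu i + m i)%N).
  suff -> : schur_poly N mu * f = P by [].
  by apply: (mulIf (vandermonde_neq0 N)); rewrite EP -E mulrAC.
elim: ms hms {E} => [|m ms IH] hms.
  by exists 0; [exact: schur_span0 | rewrite big_nil mul0r].
have [P spP EP] := IH (fun x h => hms x (mem_behead (s := m :: ms) h)).
have [|Q spQ EQ] := @alternant_span N (fun i => (rho_exp (n := N) mu i + m i)%N).
  rewrite big_split /= sum_rho_exp // -mdegE hms ?mem_head //.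
  by rewrite addnAC.
exists (f@_m *: Q + P); first exact: schur_span_lin.
by rewrite big_cons mulrDl -scalerAl EQ EP.
Qed.

End LittlewoodRichardson.

Definition lr_coef (la mu nu : seq nat) : int :=
  let N := (sumn mu + sumn nu)%N in
  if sumn la == N
  then xchoose (lr_expansion mu nu) [tuple inord (nth 0%N la i) | i < N]
  else 0.

(* [lr_coef la mu nu] vanishes unless |mu| + |nu| = |la|, so it suffices to let
   mu and nu have at most |la| parts, all at most |la|. *)
Definition LS (F : fieldType) (la : seq nat) (X Y : seq F) : F :=
  let N := sumn la in
  \sum_(mu : N.-tuple 'I_N.+1 | is_part (vals mu))
  \sum_(nu : N.-tuple 'I_N.+1 | is_part (vals nu))
    (lr_coef la (vals mu) (vals nu))%:~R
    * schur (vals mu) X * schur (conj_part (vals nu)) Y.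

Definition add_rho (a : nat) (mu : seq nat) : seq nat :=
  mkseq (fun i => nth 0 mu i + (a - i.+1))%N a.

(* [None] stands for the symbol oo. *)
Definition overlap (a b : nat) (mu nu : seq nat) : option (seq nat) :=
  let w := sort geq (add_rho a mu ++ add_rho b nu) in
  let ka := mkseq (fun i => nth 0 w i - (a + b - i.+1))%N (a + b) in
  if is_part ka && (add_rho (a + b) ka == w) then Some ka else None.

Lemma add_rho_gtn (a : nat) (ka : seq nat) :
  is_part ka -> size ka = a -> sorted gtn (add_rho a ka).
Proof.
move=> pk sk; apply/(sortedP 0%N) => i; rewrite size_mkseq => lti.
rewrite !nth_mkseq //; last exact: ltnW.
by have /(sortedP 0%N)/(_ i) := pk; rewrite sk => /(_ lti) /=; rewrite /geq /=; lia.
Qed.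

Lemma overlapP (a b : nat) (mu nu ka : seq nat) :
  overlap a b mu nu = Some ka <->
  [/\ size ka = (a + b)%N, is_part ka
    & perm_eq (add_rho (a + b) ka) (add_rho a mu ++ add_rho b nu)].
Proof.
rewrite /overlap; set w := sort _ _; set ka' := mkseq _ _.
have gT : transitive geq by exact: (rev_trans leq_trans).
split.
  case: ifP => // /andP[pk /eqP Ek] [<-]; split; rewrite ?size_mkseq //.
  by rewrite Ek perm_sort.
case=> sk pk pe.
have Ew : add_rho (a + b) ka = w.
  apply: (sorted_eq gT); last by rewrite perm_sym perm_sort perm_sym.
  - by move=> x y /=; rewrite /geq /= -eqn_leq => /eqP.
  - by apply: sub_sorted (add_rho_gtn pk sk) => x y /= /ltnW.
  - by apply: sort_sorted => x y; exact: leq_total.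
have -> : ka' = ka.
  apply: (@eq_from_nth _ 0%N); rewrite size_mkseq ?sk // => i lti.
  by rewrite nth_mkseq // -Ew nth_mkseq // addnK.
by rewrite pk Ew eqxx.
Qed.

Definition overlap_sign (a b : nat) (mu nu : seq nat) : int :=
  let w := add_rho a mu ++ add_rho b nu in
  if overlap a b mu nu is Some ka then
    if [pick s : 'S_(a + b)
         | [seq nth 0%N w (s i) | i <- enum 'I_(a + b)] == add_rho (a + b) ka]
    is Some s then (-1) ^+ s else 1
  else 1.

(* Hence all pairs with a given overlap [ka] live in a finite type of tuples. *)
Lemma overlap_bound (a b : nat) (mu nu ka : seq nat) :
  size mu = a -> size nu = b -> overlap a b mu nu = Some ka ->
  {in mu ++ nu, forall x, x <= head 0 ka + (a + b)}%N.
Proof.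
move=> sa sb /overlapP[sk pk pe] x.
have aux c (be : seq nat) : size be = c -> x \in be ->
    exists2 y, y \in add_rho c be & (x <= y)%N.
  move=> sc /(nthP 0%N)[i lti <-]; rewrite sc in lti.
  exists (nth 0 be i + (c - i.+1))%N; last exact: leq_addr.
  by apply/mapP; exists i; rewrite ?mem_iota.
have {}aux : x \in mu ++ nu ->
    exists2 y, y \in add_rho (a + b) ka & (x <= y)%N.
  rewrite mem_cat => /orP[] /aux h; [have [y iny ley] := h _ sa | have [y iny ley] := h _ sb];
  by exists y; rewrite // (perm_mem pe) mem_cat iny ?orbT.
move=> /aux[y /mapP[i]]; rewrite mem_iota => /andP[_ lti] -> le.
apply: (leq_trans le); apply: leq_add; last exact: leq_subr.
have gT : transitive geq by exact: (rev_trans leq_trans).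
have h0 : nth 0%N ka 0 = head 0%N ka by rewrite nth0.
rewrite -h0; apply: (sorted_leq_nth gT leqnn 0%N pk 0%N i) => //; rewrite inE sk //.
by apply: leq_trans lti.
Qed.

(* The subsequence of [Y] at the positions in [A]. *)
Definition subseq_at (F : Type) (m : nat) (Y : m.-tuple F) (A : {set 'I_m}) : seq F :=
  [seq tnth Y i | i <- enum A].

(* Main.v *)
(** Every Littlewood-Schur function is a Jacobi-Trudi determinant in the coefficients of
    [prod_y (1 + y t) / prod_x (1 - x t)]: expand the products
    [prod_i h(z_i)] in Schur polynomials in [z] (Cauchy-Binet), take for [h] the complete
    generating function of [X] or the elementary one of [Y] (whose coefficients are then
    Schur polynomials, by Jacobi-Trudi and its dual), multiply, and read off a coefficient.

    Replace [S], [T], [Y] by their negatives, let [K = m + N] with [N] large, and let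
    [P_S], [P_T] be the monic polynomials with roots [S], [T].  On polynomials in [w] of
    degree [< K] consider the evaluations at the elements of [Y] and, for each entry of
    [la + rho_N], the extraction of a coefficient of [g / (P_S P_T)] expanded at infinity.
    In the monomial basis the determinant of these [K] functionals is
    [LS_la * Delta(Y)].  In the family [P_T w^j] ([j < l]), [P_S w^j] ([j < K - l]), whose
    determinant is [Delta(S;T)], the first [l] columns only see [S] and the others only see
    [T].  Laplace expansion along these two blocks therefore gives products of two
    determinants of the same kind, which is the theorem: a choice of [l] rows is a subset
    [U] of [Y] and a subset [mu + rho] of [la + rho]; rows beyond the first [n - k] parts
    of [la] vanish on the first block. *)

Require Import Defs.
From mathcomp Require Import all_boot all_order all_fingroup all_algebra.
From mathcomp Require Import mpoly.
From mathcomp Require Import zify ring.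

Set Implicit Arguments.
Unset Strict Implicit.
Unset Printing Implicit Defensive.

Import Order.TTheory GRing.Theory Num.Theory.

Local Open Scope ring_scope.

(** * Determinants, signs and the Laplace and Cauchy-Binet formulas *)

(** The index of [la] enters through a single threshold. After reversal in degree [K], the functions
    [P_T w^j] with [j < l] leave a common factor ['X^t] with [t = K - n], so an extraction row
    survives on the first block exactly when its entry of [la + rho_N] is at least [t]. For
    [N = (n - k) + r] one has [t = r + (m - k)], while the parts of [la] are at least [m - k] among
    the first [n - k] and at most [m - k] afterwards; the survivors are therefore the first [n - k]
    rows. The same [t], less the padding [r], is the rectangle removed from [mu]. Expansions at
    infinity become coefficients of reversed polynomials, and the complete generating series is
    truncated at a degree [B] larger than every index that is extracted. Signs are compared through
    Vandermonde products of distinct integers, which identifies the Laplace sign with the sign of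
    the overlap. Littlewood-Richardson coefficients are given only by a choice subject to an
    expansion; multiplication by the Vandermonde product turns them into coefficients of single
    monomials. *)

Definition fdet (R : comNzRingType) (n : nat) (F : nat -> nat -> R) : R :=
  \det (\matrix_(i < n, j < n) F i j).

Lemma eq_fdet (R : comNzRingType) n (F G : nat -> nat -> R) :
  (forall i j, (i < n)%N -> (j < n)%N -> F i j = G i j) -> fdet n F = fdet n G.
Proof. by move=> E; congr (\det _); apply/matrixP => i j; rewrite !mxE E. Qed.

(* The differences are opposite to those in [delta]. *)
Fixpoint vdm (R : comNzRingType) (s : seq R) : R :=
  if s is x :: s' then \prod_(y <- s') (y - x) * vdm s' else 1.

Lemma delta2_consr (R : comNzRingType) (s t : seq R) x :
  delta2 t (x :: s) = \prod_(y <- t) (y - x) * delta2 t s.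
Proof. by rewrite /delta2 -big_split; apply: eq_bigr => y _; rewrite big_cons. Qed.

Lemma vdm_cat (R : comNzRingType) (s t : seq R) :
  vdm (s ++ t) = vdm s * vdm t * delta2 t s.
Proof.
elim: s => [|x s IH] /=.
  by rewrite /delta2 mul1r big1 ?mulr1 // => y _; rewrite big_nil.
by rewrite big_cat IH delta2_consr /=; ring.
Qed.

Lemma vdm_nth (R : comNzRingType) (s : seq R) n : size s = n ->
  vdm s = \prod_(i < n) \prod_(j < n | (i < j)%N) (s`_j - s`_i).
Proof.
elim: s n => [|x s IH] n <- /=; first by rewrite big_ord0.
rewrite big_ord_recl; congr (_ * _).
  by rewrite [RHS]big_mkcond big_ord_recl /= mul1r (big_nth 0) big_mkord.
rewrite (IH _ erefl); apply: eq_bigr => i _.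
by rewrite [RHS]big_mkcond big_ord_recl /= mul1r -big_mkcond.
Qed.

Lemma vdm_fdet (R : comNzRingType) (s : seq R) n : size s = n ->
  fdet n (fun i j => s`_i ^+ j) = vdm s.
Proof.
move=> sz; rewrite (vdm_nth sz) /fdet -det_tr.
have -> : (\matrix_(i < n, j < n) s`_i ^+ j)^T = Vandermonde n (\row_i s`_i).
  by apply/matrixP => i j; rewrite !mxE.
rewrite det_Vandermonde; apply: eq_bigr => i _; apply: eq_bigr => j _.
by rewrite !mxE.
Qed.

Lemma vdm_uniq (R : idomainType) (s : seq R) : (vdm s != 0) = uniq s.
Proof.
elim: s => [|x s IH] /=; first by rewrite oner_eq0.
rewrite mulf_eq0 negb_or IH; congr (_ && _).
rewrite prodf_seq_neq0 -has_pred1 -all_predC; apply: eq_all => y /=.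
by rewrite subr_eq0.
Qed.

Lemma perm_eq_nth (u v : seq nat) n : size u = n -> perm_eq u v ->
  exists s : 'S_n, forall i : 'I_n, nth 0%N v i = nth 0%N u (s i).
Proof.
move=> sz; rewrite perm_sym => pe; have sv : size v = n by rewrite (perm_size pe).
have [|s Es] := @tuple_permP _ n v (Tuple (introT eqP sz)) _; first exact: pe.
exists s => i; rewrite Es (nth_map i) ?size_enum_ord // nth_ord_enum.
by rewrite (tnth_nth 0%N).
Qed.

(* The sign of a rearrangement is read off the Vandermonde products. *)
Lemma sign_vdm (u v : seq nat) n k (s : 'S_n) : size u = n -> size v = n -> uniq u ->
  (forall i : 'I_n, nth 0%N v i = nth 0%N u (s i)) ->
  vdm (map Posz v) = (-1) ^+ k * vdm (map Posz u) ->
  (-1) ^+ s = (-1) ^+ k :> int.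
Proof.
move=> su sv uu Es; rewrite -(@vdm_fdet _ (map Posz v) n) ?size_map //.
have -> : fdet n (fun i j => (map Posz v)`_i ^+ j) = (-1) ^+ s * vdm (map Posz u).
  rewrite -(@vdm_fdet _ (map Posz u) n) ?size_map // /fdet -det_perm -det_mulmx -row_permE.
  congr (\det _); apply/matrixP => i j; rewrite !mxE.
  by rewrite !(nth_map 0%N) ?su ?sv ?ltn_ord // Es.
apply: mulIf; rewrite vdm_uniq map_inj_uniq //; by move=> x y [].
Qed.

Lemma intr_sign (R : pzRingType) b : ((-1) ^+ b : int)%:~R = (-1) ^+ b :> R.
Proof. by rewrite rmorphXn /= rmorphN1. Qed.

Lemma fdet_perm_rows (R : comNzRingType) (u v : seq nat) n k (F : nat -> nat -> R) :
  size u = n -> perm_eq u v -> uniq u ->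
  vdm (map Posz v) = (-1) ^+ k * vdm (map Posz u) ->
  fdet n (fun i j => F (nth 0%N v i) j) =
  (-1) ^+ k * fdet n (fun i j => F (nth 0%N u i) j).
Proof.
move=> su pe uu E; have [s Es] := perm_eq_nth su pe.
have sv : size v = n by rewrite -(perm_size pe).
have := sign_vdm su sv uu Es E => /(congr1 (fun x : int => x%:~R : R)).
rewrite !intr_sign => <-; rewrite /fdet -det_perm -det_mulmx -row_permE.
by congr (\det _); apply/matrixP => i j; rewrite !mxE Es.
Qed.

(** * Position lists of subsets and signs of shuffles *)

Definition pos n (I : {set 'I_n}) : seq nat := [seq val i | i <- enum I].

(** For disjoint increasing lists this is the exponent of the sign of the shuffle that merges
    [s ++ t]. *)
Definition inversions (s t : seq nat) : nat := (\sum_(i <- s) \sum_(j <- t) (j < i))%N.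

Lemma size_pos n (I : {set 'I_n}) : size (pos I) = #|I|.
Proof. by rewrite size_map cardE. Qed.

Lemma mem_pos n (I : {set 'I_n}) (i : 'I_n) : (val i \in pos I) = (i \in I).
Proof. by rewrite mem_map ?mem_enum //; exact: val_inj. Qed.

Lemma pos_filter n (I : {set 'I_n}) : pos I = [seq i <- iota 0 n | i \in pos I].
Proof.
rewrite -val_enum_ord filter_map {1}/pos; congr (map _ _).
rewrite enumT; apply: eq_filter => i /=.
by rewrite mem_pos.
Qed.

Lemma pos_sorted n (I : {set 'I_n}) : sorted ltn (pos I).
Proof.
by rewrite pos_filter; apply: sorted_filter (iota_ltn_sorted _ _); exact: ltn_trans.
Qed.

Lemma uniq_pos n (I : {set 'I_n}) : uniq (pos I).
Proof. by rewrite map_inj_uniq ?enum_uniq //; exact: val_inj. Qed.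

Lemma perm_pos n (I : {set 'I_n}) : perm_eq (iota 0 n) (pos I ++ pos (~: I)).
Proof.
rewrite -val_enum_ord -map_cat; apply: perm_map; apply: uniq_perm.
- exact: enum_uniq.
- rewrite cat_uniq !enum_uniq andbT /=; apply/hasPn => x.
  by rewrite !mem_enum inE.
- by move=> x; rewrite mem_cat !mem_enum !inE orbN.
Qed.

Lemma vdm_sorted (R : comNzRingType) (s : seq nat) (f : nat -> R) : sorted ltn s ->
  vdm (map f s) = \prod_(i <- s) \prod_(j <- s | (i < j)%N) (f j - f i).
Proof.
elim: s => [|x s IH] so; first by rewrite big_nil.
have ax : all (ltn x) s by move: so; rewrite /= (path_sortedE ltn_trans) => /andP[].
rewrite big_cons /= big_cons ltnn big_map (IH (path_sorted so)); congr (_ * _).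
  rewrite [RHS]big_seq_cond [LHS]big_seq; apply: eq_bigl => y.
  by case: (boolP (y \in s)) => //= /(allP ax) /= ->.
rewrite big_seq [RHS]big_seq; apply: eq_bigr => i ii.
by rewrite big_cons ltnNge ltnW //; apply: (allP ax).
Qed.

Lemma sign_prod (R : comNzRingType) (I : Type) (s : seq I) (a : I -> nat) :
  \prod_(i <- s) (-1) ^+ a i = (-1) ^+ (\sum_(i <- s) a i)%N :> R.
Proof. by elim: s => [|x s IH]; rewrite ?big_nil // !big_cons exprD IH. Qed.

(** Each pair with one member in [s] and one in [t] occurs once on the left, as the larger position
    minus the smaller; on the right it is always oriented from [s] to [t], which costs a sign
    exactly at an inversion. *)
Lemma inversions_cross (R : comNzRingType) (s t : seq nat) (f : nat -> R) : uniq (s ++ t) ->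
  (\prod_(i <- s) \prod_(j <- t | (i < j)%N) (f j - f i)) *
  (\prod_(i <- t) \prod_(j <- s | (i < j)%N) (f j - f i)) =
  (-1) ^+ inversions s t * delta2 (map f t) (map f s).
Proof.
move=> us; rewrite [X in _ * X](exchange_big_dep predT) //=.
rewrite /delta2 big_map exchange_big big_map /inversions -sign_prod -!big_split /=.
rewrite big_seq [RHS]big_seq; apply: eq_bigr => j js.
rewrite -sign_prod.
rewrite [X in X * _]big_mkcond [X in _ * X]big_mkcond -!big_split /=.
rewrite big_seq [RHS]big_seq; apply: eq_bigr => i it.
have ne : j != i.
  move: us; rewrite cat_uniq => /and3P[_ /hasPn/(_ i it) /= nin _].
  by apply: contraNneq nin => <-.
by case: ltngtP ne => //= _ _; rewrite ?expr0 ?expr1; ring.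
Qed.

Lemma vdm_split (R : comNzRingType) (s t u : seq nat) (f : nat -> R) :
  sorted ltn s -> sorted ltn t -> sorted ltn u -> perm_eq u (s ++ t) ->
  vdm (map f u) = (-1) ^+ inversions s t * vdm (map f (s ++ t)).
Proof.
move=> ss st su pe.
have us : uniq (s ++ t).
  by rewrite -(perm_uniq pe) (sorted_uniq ltn_trans ltnn su).
rewrite map_cat vdm_cat !vdm_sorted // (perm_big _ pe) big_cat /=.
under eq_bigr do rewrite (perm_big _ pe) big_cat /=.
under [X in _ * X]eq_bigr do rewrite (perm_big _ pe) big_cat /=.
rewrite !big_split /= [RHS]mulrCA -(inversions_cross f us); ring.
Qed.

Lemma fdet_shuffle (R : comNzRingType) (s t u : seq nat) n (F : nat -> nat -> R) :
  sorted ltn s -> sorted ltn t -> sorted ltn u -> perm_eq u (s ++ t) -> size u = n ->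
  fdet n (fun i j => F (nth 0%N u i) j) =
  (-1) ^+ inversions s t * fdet n (fun i j => F (nth 0%N (s ++ t) i) j).
Proof.
move=> ss st su pe sz; rewrite (@fdet_perm_rows _ u (s ++ t) n (inversions s t)) ?signrMK //.
  by rewrite (sorted_uniq ltn_trans ltnn su).
by rewrite (vdm_split _ ss st su pe) signrMK.
Qed.

Lemma fdet_block (R : comNzRingType) l r (F : nat -> nat -> R) :
  (forall i j, (i < l)%N -> (j < r)%N -> F i (l + j)%N = 0) ->
  fdet (l + r) F = fdet l F * fdet r (fun i j => F (l + i)%N (l + j)%N).
Proof.
move=> F0; rewrite /fdet -[X in \det X]submxK.
set M := matrix_of_fun _ _.
have -> : ursubmx M = 0 by apply/matrixP => i j; rewrite !mxE /= F0.
by rewrite det_lblock; congr (_ * _); congr (\det _); apply/matrixP => i j; rewrite !mxE.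
Qed.

(** Permutations are grouped by the set [I] of rows that they send to the first [l] columns. One
    group is the full determinant of a masked matrix, which becomes block diagonal once the rows of
    [I] are moved to the top. *)
Lemma laplace (R : comNzRingType) l r (F : nat -> nat -> R) :
  fdet (l + r) F =
  \sum_(I : {set 'I_(l + r)} | #|I| == l)
    (-1) ^+ inversions (pos I) (pos (~: I)) *
    fdet l (fun i j => F (nth 0%N (pos I) i) j) *
    fdet r (fun i j => F (nth 0%N (pos (~: I)) i) (l + j)%N).
Proof.
pose low (s : 'S_(l + r)) := [set i | s i < l]%N.
have card_low s : #|low s| == l.
  have -> : low s = s @^-1: [set j : 'I_(l + r) | j < l]%N by apply/setP => i; rewrite !inE.
  rewrite -[X in _ == X]card_ord on_card_preimset; last first.
    by exists (s^-1)%g => x _; rewrite (permK, permKV).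
  rewrite -(card_imset _ (@lshift_inj l r)); apply/eqP/eq_card => j; rewrite inE.
  apply/idP/imsetP => [lt|[i _ ->]]; last exact: (ltn_ord i).
  by exists (Ordinal lt) => //; apply: val_inj.
rewrite {1}/fdet /determinant (partition_big low (fun I => #|I| == l)) //=.
apply: eq_bigr => I /eqP cI.
(* The mask kills every permutation outside the group of [I] and leaves the terms of that group
   unchanged. *)
pose G i j := if (i \in pos I) == (j < l)%N then F i j else 0.
transitivity (fdet (l + r) G).
  rewrite /fdet /determinant [RHS](bigID (fun s => low s == I)) /= [X in _ + X]big1.
    rewrite addr0; apply: eq_bigr => s /eqP Es; congr (_ * _); apply: eq_bigr => i _.
    by rewrite !mxE /G mem_pos -Es !inE eqxx.
  move=> s nlow; have [i ni] : exists i, (i \in I) != (s i < l)%N.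
    apply/existsP; apply: contraNT nlow => /existsPn h; apply/eqP/setP => i.
    by have := h i; rewrite negbK inE => /eqP ->.
  by rewrite (bigD1 i) //= !mxE /G mem_pos (negbTE ni) mul0r mulr0.
transitivity (fdet (l + r) (fun i j => G (nth 0%N (iota 0 (l + r)) i) j)).
  by apply: eq_fdet => i j lti _; rewrite nth_iota.
rewrite (fdet_shuffle G (pos_sorted I) (pos_sorted (~: I)) (iota_ltn_sorted _ _)
   (perm_pos I)) ?size_iota // -mulrA; congr (_ * _).
have sI : size (pos I) = l by rewrite size_pos.
have sJ : size (pos (~: I)) = r.
  by rewrite size_pos; have := cardsC I; rewrite card_ord cI => /addnI.
have ninI x : x \in pos (~: I) -> x \notin pos I.
  move=> xI; have : uniq (pos I ++ pos (~: I)) by rewrite -(perm_uniq (perm_pos I)) iota_uniq.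
  by rewrite cat_uniq => /and3P[_ /hasPn/(_ x xI)].
rewrite fdet_block; first congr (_ * _).
- apply: eq_fdet => i j lti ltj.
  by rewrite nth_cat sI lti /G ltj mem_nth ?sI.
- apply: eq_fdet => i j lti ltj.
  rewrite nth_cat sI ltnNge leq_addr addKn /G (negbTE (ninI _ _)) ?mem_nth ?sJ //.
  by rewrite ltnNge leq_addr.
- move=> i j lti ltj; rewrite nth_cat sI lti /G mem_nth ?sI //.
  by rewrite (ltnNge (l + j)) leq_addr.
Qed.

(** Expanding all the sums gives one term per map from columns to summation indices. A map that is
    not injective repeats a column; the injective maps with image [I] are the increasing enumeration
    of [I] composed with a permutation. *)
Lemma cauchy_binet (R : comNzRingType) n k (A B : nat -> nat -> R) :
  fdet n (fun i j => \sum_(e < k) A i e * B e j) =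
  \sum_(I : {set 'I_k} | #|I| == n)
    fdet n (fun i j => A i (nth 0%N (pos I) j)) * fdet n (fun i j => B (nth 0%N (pos I) i) j).
Proof.
pose im (f : {ffun 'I_n -> 'I_k}) := [set f i | i : 'I_n].
pose MA (f : {ffun 'I_n -> 'I_k}) := \det (\matrix_(i < n, j < n) A i (f j)).
transitivity (\sum_(f : {ffun 'I_n -> 'I_k}) MA f * \prod_j B (f j) j).
  rewrite /fdet /determinant.
  transitivity (\sum_(s : 'S_n) \sum_(f : {ffun 'I_n -> 'I_k})
     (-1) ^+ s * \prod_j (A (s^-1 j)%g (f j) * B (f j) j)).
    apply: eq_bigr => s _; rewrite -big_distrr /=; congr (_ * _).
    rewrite (reindex_inj (@perm_inj _ s^-1%g)) /=.
    under eq_bigr do rewrite mxE permKV.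
    by rewrite bigA_distr_bigA.
  rewrite exchange_big; apply: eq_bigr => f _ /=.
  rewrite /MA /determinant mulr_suml; apply: eq_bigr => s _.
  rewrite big_split mulrA; congr (_ * _ * _).
  rewrite (reindex_inj (@perm_inj _ s)) /=; apply: eq_bigr => j _.
  by rewrite mxE permK.
rewrite (bigID (fun f : {ffun 'I_n -> 'I_k} => injectiveb f)) /= [X in _ + X]big1 ?addr0;
  last first.
  move=> f /injectivePn[i [j nij Eij]].
  rewrite /MA -det_tr (determinant_alternate nij) ?mul0r // => r.
  by rewrite !mxE Eij.
rewrite (partition_big im (fun I => #|I| == n)) /=; last first.
  by move=> f /injectiveP inj; rewrite card_imset // card_ord.
apply: eq_bigr => I /eqP cI.
have sI : size (pos I) = n by rewrite size_pos.
have lt_pos i : (i < n)%N -> (nth 0%N (pos I) i < k)%N.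
  move=> lti; have /mapP[x _ ->] : nth 0%N (pos I) i \in pos I by rewrite mem_nth ?sI.
  exact: ltn_ord.
pose g (s : 'S_n) : {ffun 'I_n -> 'I_k} :=
  [ffun j => Ordinal (lt_pos (s j) (ltn_ord (s j)))].
have gE s j : val (g s j) = nth 0%N (pos I) (s j) by rewrite ffunE.
have uI := uniq_pos I.
rewrite (reindex g) /=; last first.
  (* The inverse of [g] on injective maps with image [I]; the default [1] is never reached there. *)
  pose h (f : {ffun 'I_n -> 'I_k}) : 'S_n :=
    odflt 1%g [pick s : 'S_n | [forall j, val (f j) == nth 0%N (pos I) (s j)]].
  exists h => [s _|f].
    rewrite /h; case: pickP => [s' /forallP /= E|/(_ s)]; last first.
      by move/negP; case; apply/forallP => j; rewrite gE.
    apply/permP => j; apply/val_inj/eqP; rewrite /= -(nth_uniq 0%N _ _ uI) ?sI //.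
    by rewrite -(eqP (E j)) gE.
  rewrite inE => /andP[/injectiveP inj /eqP Ef].
  have idx j : (index (val (f j)) (pos I) < n)%N.
    have : val (f j) \in pos I by rewrite mem_pos -Ef imset_f.
    by rewrite -index_mem sI.
  have idx_inj : injective (fun j => Ordinal (idx j)).
    move=> i j [] Eij; apply: inj; apply: val_inj.
    rewrite -(nth_index 0%N (_ : val (f i) \in pos I)); last by rewrite mem_pos -Ef imset_f.
    by rewrite Eij nth_index // mem_pos -Ef imset_f.
  rewrite /h; case: pickP => [s /forallP /= E|/(_ (perm idx_inj))].
    by apply/ffunP => j; apply: val_inj; rewrite gE -(eqP (E j)).
  move/negP; case; apply/forallP => j; rewrite permE /= nth_index //.
  by rewrite mem_pos -Ef imset_f.
transitivity (\sum_(s : 'S_n) (-1) ^+ s * fdet n (fun i j => A i (nth 0%N (pos I) j)) *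
    \prod_j B (nth 0%N (pos I) (s j)) j).
  apply: eq_big => [s|s _].
    have inj : injective (g s).
      move=> i j /(congr1 val); rewrite !gE => /eqP; rewrite nth_uniq ?sI //.
      by move/eqP/val_inj/perm_inj.
    apply/andP; split; first exact/injectiveP.
    rewrite eqEcard card_imset // card_ord cI leqnn andbT.
    apply/subsetP => x /imsetP[j _ ->]; rewrite -mem_pos gE mem_nth ?sI //.
  congr (_ * _); last by apply: eq_bigr => j _; rewrite gE.
  rewrite /MA /fdet -det_tr -[X in _ = _ * X]det_tr -det_perm -det_mulmx -row_permE; congr (\det _).
  by apply/matrixP => i j; rewrite !mxE gE.
rewrite [X in _ = _ * X]/fdet -det_tr /determinant mulr_sumr; apply: eq_bigr => s _.
rewrite mulrCA mulrA; congr (_ * _ * _).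
by apply: eq_bigr => i _; rewrite !mxE.
Qed.

Lemma fdet_mul (R : comNzRingType) n (A B : nat -> nat -> R) :
  fdet n (fun i j => \sum_(c < n) A i c * B c j) = fdet n A * fdet n B.
Proof.
rewrite /fdet -det_mulmx; congr (\det _); apply/matrixP => i j; rewrite !mxE.
by apply: eq_bigr => c _; rewrite !mxE.
Qed.

Lemma fdet_upper (R : comNzRingType) n (A : nat -> nat -> R) :
  (forall i j, (j < i)%N -> (i < n)%N -> A i j = 0) -> fdet n A = \prod_(i < n) A i i.
Proof.
move=> A0; rewrite /fdet -det_tr det_trig.
  by apply: eq_bigr => i _; rewrite !mxE.
by apply/is_trig_mxP => i j ltij; rewrite !mxE A0.
Qed.

Lemma fdet_lower (R : comNzRingType) n (A : nat -> nat -> R) :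
  (forall i j, (i < j)%N -> (j < n)%N -> A i j = 0) -> fdet n A = \prod_(i < n) A i i.
Proof.
move=> A0; rewrite /fdet det_trig; first by apply: eq_bigr => i _; rewrite !mxE.
by apply/is_trig_mxP => i j ltij; rewrite !mxE A0.
Qed.

Lemma fdet_scale (R : comNzRingType) n (a : nat -> R) (A : nat -> nat -> R) :
  fdet n (fun i j => a i * A i j) = (\prod_(i < n) a i) * fdet n A.
Proof.
rewrite /fdet /determinant mulr_sumr; apply: eq_bigr => s _.
rewrite mulrCA -big_split; congr (_ * _).
by apply: eq_bigr => i _; rewrite !mxE.
Qed.

(** * Determinants of evaluations and coefficient extractions *)

(* For [d = add_rho N la] the entry [(i, c)] is the coefficient of [h] of index
   [la_i - i + c], and [0] when this index is negative. *)
Definition jacobi_trudi (R : comNzRingType) (N : nat) (h : {poly R}) (d : seq nat) : R :=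
  fdet N (fun i c => (h * 'X^(N - c.+1))`_(nth 0%N d i)).

Definition root_poly (R : comNzRingType) (X : seq R) : {poly R} :=
  \prod_(x <- X) ('X - x%:P).

(** The sign is chosen so that this is the reversal of [root_poly X] and the inverse of the complete
    generating series; the elementary generating function is its value at [-X]. *)
Definition esym_gen (R : comNzRingType) (X : seq R) : {poly R} :=
  \prod_(x <- X) (1 - x *: 'X).

(** For [g] of degree less than [K] this is [w^(K-1) * g(1/w)]: coefficients of an expansion at
    infinity become coefficients at 0. *)
Definition reverse_poly (R : comNzRingType) K (g : {poly R}) : {poly R} :=
  \sum_(c < K) g`_c *: 'X^(K - c.+1).

Lemma size_root_poly (R : comNzRingType) (X : seq R) : size (root_poly X) = (size X).+1.
Proof. by rewrite size_prod_XsubC. Qed.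

Lemma monic_root_poly (R : comNzRingType) (X : seq R) : root_poly X \is monic.
Proof. exact: monic_prod_XsubC. Qed.

Lemma root_poly_horner (R : comNzRingType) (X : seq R) y :
  (root_poly X).[y] = \prod_(x <- X) (y - x).
Proof. by rewrite horner_prod; apply: eq_bigr => x _; rewrite !hornerE. Qed.

Lemma root_poly_root (R : comNzRingType) (X : seq R) y : y \in X -> (root_poly X).[y] = 0.
Proof. by move=> yX; rewrite root_poly_horner (big_rem y) //= subrr mul0r. Qed.

Lemma reverse_polyX (R : comNzRingType) K j : (j < K)%N ->
  reverse_poly K ('X^j : {poly R}) = 'X^(K - j.+1).
Proof.
move=> lt; rewrite /reverse_poly (bigD1 (Ordinal lt)) //= coefXn eqxx scale1r big1 ?addr0 //.
by move=> i /negbTE ni; rewrite coefXn -[_ == _ :> nat]/(i == Ordinal lt) ni scale0r.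
Qed.

Lemma reverse_poly_XsubC (R : comNzRingType) K (g : {poly R}) x : (size g <= K)%N ->
  reverse_poly K.+1 (('X - x%:P) * g) = (1 - x *: 'X) * reverse_poly K g.
Proof.
move=> sg.
have -> : reverse_poly K.+1 (('X - x%:P) * g) =
  reverse_poly K.+1 ('X * g) - x *: reverse_poly K.+1 g.
  rewrite /reverse_poly scaler_sumr -sumrB; apply: eq_bigr => c _.
  by rewrite mulrBl coefB coefCM scalerBl scalerA.
have -> : reverse_poly K.+1 ('X * g) = reverse_poly K g.
  rewrite /reverse_poly big_ord_recl coefXM eqxx scale0r add0r; apply: eq_bigr => c _.
  by rewrite coefXM /= /bump /= add1n subSS.
have -> : reverse_poly K.+1 g = 'X * reverse_poly K g.
  rewrite /reverse_poly big_ord_recr /= nth_default // scale0r addr0 mulr_sumr.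
  apply: eq_bigr => c _; rewrite -scalerAr -exprS; congr (_ *: 'X^_).
  by have := ltn_ord c; lia.
by rewrite mulrBl mul1r scalerAl.
Qed.

Lemma size_root_polyM (R : comNzRingType) (X : seq R) (g : {poly R}) K :
  (size g <= K)%N -> (size (root_poly X * g)%R <= size X + K)%N.
Proof.
move=> sg; apply: leq_trans (size_polyMleq _ _) _; by rewrite size_root_poly addSn /= leq_add2l.
Qed.

Lemma reverse_poly_root_poly (R : comNzRingType) (X : seq R) K (g : {poly R}) : (size g <= K)%N ->
  reverse_poly (size X + K) (root_poly X * g) = esym_gen X * reverse_poly K g.
Proof.
move=> sg; elim: X => [|x X IH]; first by rewrite /root_poly /esym_gen !big_nil !mul1r.
rewrite /root_poly /esym_gen !big_cons -!mulrA -IH; apply: reverse_poly_XsubC.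
exact: size_root_polyM.
Qed.

Lemma sum_horner (R : comNzRingType) K (g : {poly R}) y : (size g <= K)%N ->
  \sum_(c < K) y ^+ c * g`_c = g.[y].
Proof.
by move=> sg; rewrite (horner_coef_wide _ sg); apply: eq_bigr => c _; rewrite mulrC.
Qed.

Lemma sum_reverse_poly (R : comNzRingType) K (h g : {poly R}) d :
  \sum_(c < K) (h * 'X^(K - c.+1))`_d * g`_c = (h * reverse_poly K g)`_d.
Proof.
rewrite /reverse_poly mulr_sumr coef_sum; apply: eq_bigr => c _.
by rewrite -scalerAr coefZ mulrC.
Qed.

(* Rows indexed by [Y] are evaluations, the others are coefficient extractions,
   of polynomials of degree less than [K] expressed in the monomial basis. *)
Definition mixed_mx (R : comNzRingType) K (Y : seq R) (h : {poly R}) (d : seq nat) :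
    nat -> nat -> R :=
  fun i c => if (i < size Y)%N then Y`_i ^+ c
             else (h * 'X^(K - c.+1))`_(nth 0%N d (i - size Y)).

Lemma sum_mixed_mx (R : comNzRingType) K (Y : seq R) h d i (g : {poly R}) :
  (size g <= K)%N ->
  \sum_(c < K) mixed_mx K Y h d i c * g`_c =
  if (i < size Y)%N then g.[Y`_i] else (h * reverse_poly K g)`_(nth 0%N d (i - size Y)).
Proof.
by move=> sg; rewrite /mixed_mx; case: ifP => _; [exact: sum_horner | exact: sum_reverse_poly].
Qed.

Lemma coef_monicX (R : comNzRingType) (p : {poly R}) c j n : p \is monic ->
  size p = n.+1 -> (n <= j)%N -> (j <= c)%N -> (p * 'X^(j - n))`_c = (c == j)%:R.
Proof.
move=> mp sp le lt; rewrite coefMXn ltnNge.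
have -> : (j - n <= c)%N by lia.
move: mp; rewrite monicE lead_coefE sp /= => /eqP p1.
case: (eqVneq c j) => [->|ne]; first by rewrite subKn.
by rewrite nth_default // sp; lia.
Qed.

(** In the unitriangular basis ['X^j] for [j < m], then [root_poly Y * 'X^(j - m)], the evaluations
    at [Y] vanish on the second kind of functions. One diagonal block is the Vandermonde matrix of
    [Y]; in the other, reversal turns [root_poly Y] into [esym_gen Y]. *)
Lemma fdet_mixed_mx (R : comNzRingType) N (Y : seq R) h d :
  fdet (size Y + N) (mixed_mx (size Y + N) Y h d) = vdm Y * jacobi_trudi N (h * esym_gen Y) d.
Proof.
set m := size Y; set K := (m + N)%N.
pose g j : {poly R} := if (j < m)%N then 'X^j else root_poly Y * 'X^(j - m).
have szg j : (j < K)%N -> (size (g j) <= K)%N.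
  rewrite /g; case: (ltnP j m) => le lt; first by rewrite size_polyXn.
  by apply: size_root_polyM; rewrite size_polyXn; lia.
have dtg : fdet K (fun c j => (g j)`_c) = 1.
  have gE c j : (j <= c)%N -> (g j)`_c = (c == j)%:R.
    rewrite /g; case: (ltnP j m) => le lt; first by rewrite coefXn.
    by rewrite (coef_monicX (monic_root_poly Y) (size_root_poly Y)).
  rewrite fdet_upper; first by rewrite big1 // => i _; rewrite gE ?eqxx.
  by move=> i j lt _; rewrite gE 1?ltnW // gtn_eqF.
rewrite -[LHS]mulr1 -dtg -fdet_mul.
rewrite (@eq_fdet _ _ _ (fun i j => if (i < m)%N then (g j).[Y`_i]
    else (h * reverse_poly K (g j))`_(nth 0%N d (i - m)))); last first.
  by move=> i j _ ltj; rewrite sum_mixed_mx ?szg.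
rewrite fdet_block; last first.
  move=> i j lti _; rewrite lti /g ltnNge leq_addr /= hornerM root_poly_root ?mul0r //.
  by rewrite mem_nth.
congr (_ * _).
  rewrite -(@vdm_fdet _ Y m) //; apply: eq_fdet => i j lti ltj.
  by rewrite lti /g ltj hornerXn.
apply: eq_fdet => i j lti ltj.
rewrite !ltnNge !leq_addr /= addKn /g ltnNge leq_addr /= addKn.
by rewrite reverse_poly_root_poly ?size_polyXn // reverse_polyX // mulrA.
Qed.

(** Division of [q] by ['X - s_j] gives [q * N j = q.[s j] * N j + q' * N (j + 1)], and the degree
    of [q'] has dropped. The expansion thus starts at [N j], which is the source of the
    triangularity below. *)
Lemma newton_basis (R : comNzRingType) (s : nat -> R) K n j (q : {poly R}) :
  let N j := \prod_(0 <= i < j) ('X - (s i)%:P) in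
  (size q <= n)%N -> (j + n <= K)%N -> exists u : {ffun 'I_K -> R},
  [/\ q * N j = \sum_(i < K) u i *: N i, forall i : 'I_K, (i < j)%N -> u i = 0
    & forall i : 'I_K, i = j :> nat -> u i = q.[s j]].
Proof.
move=> N; elim: n j q => [|n IH] j q sq le.
  exists [ffun=> 0]; move: sq; rewrite leqn0 size_poly_eq0 => /eqP ->; split.
  - by rewrite mul0r big1 // => i _; rewrite ffunE scale0r.
  - by move=> i _; rewrite ffunE.
  - by move=> i _; rewrite ffunE horner0.
have /factor_theorem[q' Eq] : root (q - q.[s j]%:P) (s j).
  by rewrite /root !hornerE subrr.
have sq' : (size q' <= n)%N.
  case: (eqVneq q' 0) => [->|nz]; first by rewrite size_poly0.
  have := size_Mmonic nz (monicXsubC (s j)); rewrite size_XsubC addn2 /= => E.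
  rewrite -ltnS -E -Eq (leq_trans (size_polyD _ _)) // geq_max sq size_polyN.
  by rewrite (leq_trans (size_polyC_leq1 _)).
have {}Eq : q = q' * ('X - (s j)%:P) + q.[s j]%:P by rewrite -Eq subrK.
have [|u [E1 u0 uj]] := IH j.+1 q' sq'; first by rewrite addSn -addnS.
have ltj : (j < K)%N by lia.
exists [ffun i : 'I_K => if i == j :> nat then q.[s j] else u i]; split.
- rewrite {1}Eq mulrDl -mulrA.
  have -> : ('X - (s j)%:P) * N j = N j.+1 by rewrite /N big_nat_recr //= mulrC.
  rewrite E1 (bigD1 (Ordinal ltj)) //= (u0 (Ordinal ltj)) // scale0r add0r.
  rewrite [RHS](bigD1 (Ordinal ltj)) //= ffunE eqxx mul_polyC addrC; congr (_ + _).
  by apply: eq_bigr => i ni; rewrite ffunE -[_ == j :> nat]/(i == Ordinal ltj) (negbTE ni).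
- by move=> i lti; rewrite ffunE ltn_eqF // u0 // ltnW.
- by move=> i Ei; rewrite ffunE Ei eqxx.
Qed.

(* In the Newton basis of [S], continued by multiples of [root_poly S], multiplication by
   [root_poly T] is triangular with diagonal entries [(root_poly T).[s]]. *)
Lemma fdet_sylvester (R : comNzRingType) (S T : seq R) K :
  (size S + size T <= K)%N ->
  fdet K (fun c j => (if (j < size S)%N then root_poly T * 'X^j else root_poly S * 'X^(j - size
    S))`_c) =
  delta2 S T.
Proof.
set l := size S => leK.
pose s i := S`_i.
pose N j : {poly R} := \prod_(0 <= i < j) ('X - (s i)%:P).
have NE j : N j = root_poly [seq s i | i <- iota 0 j].
  by rewrite /N /root_poly big_map /index_iota subn0.
have szN j : size (N j) = j.+1 by rewrite NE size_root_poly size_map size_iota.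
have mN j : N j \is monic by rewrite NE monic_root_poly.
have Nbig j : (l <= j)%N -> N j = root_poly S * 'X^(j - l).
  move=> le; rewrite /N (@big_cat_nat _ _ _ l) //=; congr (_ * _).
    by rewrite /root_poly [RHS](big_nth 0).
  rewrite -prodr_const_nat big_nat [RHS]big_nat; apply: eq_bigr => i /andP[lei _].
  by rewrite /s nth_default // subr0.
have Nc c j : (j <= c)%N -> (N j)`_c = (c == j)%:R.
  by move=> le; rewrite -(coef_monicX (mN j) (szN j) (leqnn j) le) subnn mulr1.
pose q j : {poly R} := if (j < l)%N then root_poly T else 1.
have sq j : (j < K)%N -> (size (q j) <= K - j)%N.
  rewrite /q => lt; case: (ltnP j l) => le; rewrite ?size_poly1 ?size_root_poly; lia.
have exu (j : 'I_K) := @newton_basis R s K (K - j) j (q j) (sq j (ltn_ord j))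
  (eq_leq (subnKC (ltnW (ltn_ord j)))).
have [u /all_and3[u1 u2 u3]] := fin_all_exists exu.
pose U i j := if insub j is Some j' then if insub i is Some i' then u j' i' else 0 else 0.
have UE (i j : 'I_K) : U i j = u j i by rewrite /U !valK.
set C := fun c j => _.
(* Right multiplication by the unitriangular [E] replaces ['X^j] by [N j] in the first [l] columns;
   in the others [root_poly S * 'X^(j - l)] already is [N j]. *)
pose E c j := if (j < l)%N then (N j)`_c else (c == j)%:R.
have dE : fdet K E = 1.
  rewrite fdet_upper => [|i j lt _].
    by rewrite big1 // => i _; rewrite /E; case: ifP => _; rewrite ?Nc // eqxx.
  by rewrite /E; case: ifP => _; rewrite ?Nc ?gtn_eqF // ltnW.
have dN : fdet K (fun c j => (N j)`_c) = 1.
  rewrite fdet_upper => [|i j lt _]; first by rewrite big1 // => i _; rewrite Nc ?eqxx.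
  by rewrite Nc ?gtn_eqF // ltnW.
transitivity (fdet K (fun c j => (q j * N j)`_c)).
  rewrite -[LHS]mulr1 -dE -fdet_mul; apply: eq_fdet => c j _ ltj.
  rewrite /E /C /q; case: ltnP => lejl; last first.
    rewrite (bigD1 (Ordinal ltj)) //= eqxx mulr1 ltnNge lejl /= big1 ?addr0 ?mul1r ?Nbig //.
    by move=> i ni; rewrite -[_ == j :> nat]/(i == Ordinal ltj) (negbTE ni) mulr0.
  have EN : N j = \poly_(i < K) (N j)`_i.
    apply/polyP => i; rewrite coef_poly; case: ltnP => // le.
    by rewrite nth_default // szN (leq_trans ltj).
  rewrite [in RHS]EN poly_def mulr_sumr coef_sum.
  apply: eq_bigr => i _; rewrite -scalerAr coefZ mulrC.
  case: (ltnP i l) => // le.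
  by rewrite [(N j)`_i]nth_default ?szN ?(leq_trans lejl) // !mul0r.
transitivity (fdet K (fun c i => (N i)`_c) * fdet K U).
  rewrite -fdet_mul; apply: eq_fdet => c j _ ltj.
  rewrite (u1 (Ordinal ltj)) coef_sum; apply: eq_bigr => i _.
  by rewrite coefZ mulrC (UE i (Ordinal ltj)).
rewrite dN mul1r fdet_lower; last first.
  move=> i j lt ltj; rewrite (UE (Ordinal (ltn_trans lt ltj)) (Ordinal ltj)).
  exact: u2.
have leK' : (l <= K)%N by lia.
rewrite (eq_bigr (fun i : 'I_K => (q i).[s i])); last by move=> i _; rewrite UE u3.
rewrite -(big_mkord xpredT (fun i => (q i).[s i])) (@big_cat_nat _ _ _ l) //=.
rewrite [X in _ * X]big_nat [X in _ * X]big1 ?mulr1; last first.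
  by move=> i /andP[le _]; rewrite /q ltnNge le hornerC.
rewrite /delta2 [RHS](big_nth 0) -/l big_nat [RHS]big_nat; apply: eq_bigr => i /andP[_ lt].
by rewrite /q lt root_poly_horner.
Qed.

(** * Minors of the mixed matrix and the expansion along two blocks *)

Definition at_pos (T : Type) (x0 : T) (s : seq T) (q : seq nat) : seq T :=
  [seq nth x0 s i | i <- q].

Lemma fdet_row0 (R : comNzRingType) n (F : nat -> nat -> R) i0 : (i0 < n)%N ->
  (forall j, (j < n)%N -> F i0 j = 0) -> fdet n F = 0.
Proof.
move=> lt F0; rewrite /fdet /determinant big1 // => s _.
by rewrite (bigD1 (Ordinal lt)) //= !mxE F0 // mul0r mulr0.
Qed.

(** A minor is again a mixed determinant: the values of [P] come out of the evaluation rows, and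
    ['X^t] is absorbed by lowering the extracted indices by [t]. An index below [t] gives a zero
    row. *)
Lemma fdet_minor (R : comNzRingType) (Y : seq R) (h P : {poly R}) (d : seq nat) m t k
    (a b : seq nat) :
  (size a + size b)%N = k -> all (ltn^~ m) a ->
  fdet k (fun i j => let i' := nth 0%N (a ++ map (addn m) b) i in
     if (i' < m)%N then P.[Y`_i'] * Y`_i' ^+ j
     else (h * 'X^(t + (k - j.+1)))`_(nth 0%N d (i' - m))) =
  (\prod_(y <- at_pos 0 Y a) P.[y]) * vdm (at_pos 0 Y a) *
  (if all (leq t) (at_pos 0%N d b)
   then jacobi_trudi (size b) (h * esym_gen (at_pos 0 Y a)) (map (subn^~ t) (at_pos 0%N d b))
     else 0).
Proof.
move=> <- {k} am; set k := (_ + _)%N.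
have nth_a i : (i < size a)%N -> (nth 0%N (a ++ map (addn m) b) i < m)%N.
  by move=> lt; rewrite nth_cat lt; apply: (allP am); rewrite mem_nth.
have nth_b i : (size a <= i)%N -> (i < k)%N ->
    nth 0%N (a ++ map (addn m) b) i = (m + nth 0%N b (i - size a))%N.
  move=> le lt; rewrite nth_cat ltnNge le /= (nth_map 0%N) //.
  by rewrite /k in lt; lia.
case: ifP => [/allP allt|/allPn]; last first.
  move=> [x /mapP[y /(nthP 0%N)[i lti <-] ->] lt]; rewrite mulr0.
  apply: (@fdet_row0 _ _ _ (size a + i)); first by rewrite /k ltn_add2l.
  move=> j ltj /=; rewrite nth_b ?leq_addr ?ltn_add2l // addKn ltnNge leq_addr /=.
  by rewrite addKn exprD mulrCA coefXnM ltnNge lt.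
pose c i := if (i < size a)%N then P.[Y`_(nth 0%N a i)] else 1.
transitivity (fdet k (fun i j =>
  c i * mixed_mx k (at_pos 0 Y a) h (map (subn^~ t) (at_pos 0%N d b)) i j)).
  apply: eq_fdet => i j lti ltj /=; rewrite /mixed_mx /c size_map.
  case: (ltnP i (size a)) => lei.
    by rewrite nth_a // nth_cat lei (nth_map 0%N).
  rewrite nth_b // ltnNge leq_addr /= addKn mul1r.
  have ltb : (i - size a < size b)%N by rewrite /k in lti; lia.
  rewrite !(nth_map 0%N) ?size_map // exprD mulrCA coefXnM ltnNge allt //.
  by rewrite map_f // mem_nth.
have dtw d' : fdet k (mixed_mx k (at_pos 0 Y a) h d') =
    vdm (at_pos 0 Y a) * jacobi_trudi (size b) (h * esym_gen (at_pos 0 Y a)) d'.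
  by rewrite -fdet_mixed_mx size_map.
rewrite fdet_scale dtw mulrA; congr (_ * _ * _).
rewrite -(big_mkord xpredT c) (@big_cat_nat _ _ _ (size a)) ?leq_addr //=.
rewrite [X in _ * X]big_nat [X in _ * X]big1 ?mulr1; last first.
  by move=> i /andP[le _]; rewrite /c ltnNge le.
rewrite big_map [RHS](big_nth 0%N) big_nat [RHS]big_nat; apply: eq_bigr => i /andP[_ lt].
by rewrite /c lt.
Qed.

Definition join_set m N (A : {set 'I_m}) (M : {set 'I_N}) : {set 'I_(m + N)} :=
  [set k | match split k with inl i => i \in A | inr j => j \in M end].

Lemma enum_ord_add m N : enum 'I_(m + N) =
  map (@lshift m N) (enum 'I_m) ++ map (@rshift m N) (enum 'I_N).
Proof.
have V n : map (@nat_of_ord n) (enum 'I_n) = iota 0 n := val_enum_ord n.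
apply: (inj_map (@ord_inj _)); rewrite map_cat.
rewrite -(map_comp _ (@lshift m N)) -(map_comp _ (@rshift m N)).
transitivity (iota 0 m ++ map (addn m) (iota 0 N)).
  by rewrite V iotaD -iotaDl addn0.
by rewrite -!V -(map_comp (addn m)); congr (_ ++ _); apply: eq_map.
Qed.

Lemma pos_join m N (A : {set 'I_m}) (M : {set 'I_N}) :
  pos (join_set A M) = pos A ++ map (addn m) (pos M).
Proof.
have pE n (I : {set 'I_n}) : pos I = map val (filter (mem I) (enum 'I_n)).
  by rewrite /pos; congr map; rewrite enumT.
rewrite !pE enum_ord_add filter_cat map_cat !filter_map -!map_comp; congr (_ ++ _).
  congr map; apply: eq_filter => i /=; rewrite inE; by case: split_ordP => j /eqP;
    rewrite eq_shift // => /eqP ->.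
congr map; apply: eq_filter => i /=; rewrite inE; by case: split_ordP => j /eqP;
  rewrite eq_shift // => /eqP ->.
Qed.

Lemma setC_join m N (A : {set 'I_m}) (M : {set 'I_N}) :
  ~: join_set A M = join_set (~: A) (~: M).
Proof. by apply/setP => k; rewrite !inE; case: split => i; rewrite inE. Qed.

Lemma sum_join (R : nmodType) m N l (G : seq nat -> seq nat -> R) :
  \sum_(I : {set 'I_(m + N)} | #|I| == l) G (pos I) (pos (~: I)) =
  \sum_(A : {set 'I_m}) \sum_(M : {set 'I_N} | (#|A| + #|M|)%N == l)
     G (pos A ++ map (addn m) (pos M)) (pos (~: A) ++ map (addn m) (pos (~: M))).
Proof.
rewrite pair_big_dep /=.
rewrite (reindex (fun AM : {set 'I_m} * {set 'I_N} => join_set AM.1 AM.2)) /=.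
  apply: eq_big => [[A M]|[A M] _] /=; last by rewrite setC_join !pos_join.
  by rewrite -size_pos pos_join size_cat size_map !size_pos.
exists (fun I : {set 'I_(m + N)} =>
  ([set i | lshift N i \in I], [set j | rshift m j \in I])) => [[A M] _|I _] /=.
  by congr pair; apply/setP => i; rewrite !inE; case: split_ordP => j /eqP;
    rewrite eq_shift // => /eqP ->.
by apply/setP => k; rewrite inE; case: split_ordP => i ->; rewrite inE.
Qed.

Lemma inversions_cat_l s s' t : inversions (s ++ s') t = (inversions s t + inversions s' t)%N.
Proof. by rewrite /inversions big_cat. Qed.

Lemma inversions_cat_r s t t' : inversions s (t ++ t') = (inversions s t + inversions s t')%N.
Proof. by rewrite /inversions -big_split; apply: eq_bigr => i _; rewrite big_cat. Qed.

(** Evaluation rows precede extraction rows, so mixed inversions arise only between [b] and [a'],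
    and there every pair is one. *)
Lemma inversions_join m (a a' b b' : seq nat) :
  all (ltn^~ m) a -> all (ltn^~ m) a' ->
  inversions (a ++ map (addn m) b) (a' ++ map (addn m) b') =
  (inversions a a' + inversions b b' + size b * size a')%N.
Proof.
move=> am am'; rewrite inversions_cat_l !inversions_cat_r.
have -> : inversions a (map (addn m) b') = 0%N.
  rewrite /inversions big_seq big1 // => i /(allP am) /= lti.
  by rewrite big_map big1 // => j _; lia.
have -> : inversions (map (addn m) b) a' = (size b * size a')%N.
  rewrite /inversions big_map -sum1_size big_distrl /=; apply: eq_bigr => i _.
  rewrite mul1n -sum1_size big_seq [RHS]big_seq; apply: eq_bigr => j /(allP am') /= lt.
  by rewrite ltn_addr.
have -> : inversions (map (addn m) b) (map (addn m) b') = inversions b b'.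
  rewrite /inversions big_map; apply: eq_bigr => i _; rewrite big_map.
  by apply: eq_bigr => j _; rewrite ltn_add2l.
by rewrite addn0 addnA addnAC.
Qed.

Lemma all_pos n (I : {set 'I_n}) : all (ltn^~ n) (pos I).
Proof. by apply/allP => _ /mapP[i _ ->] /=; apply: ltn_ord. Qed.

(** [hS] and [hT] play the role of [h] with the factor of [T], respectively [S], cancelled. For
    truncated series this cancellation holds only below index [B], hence the bound on the entries of
    [d]. *)
Lemma jacobi_trudi_split (R : comNzRingType) (S T Y : seq R) m l N B (h hS hT : {poly R})
    (d : seq nat) :
  size Y = m -> size S = l ->
  let t := (m + N - (l + size T))%N in
  (l + size T <= m + N)%N ->
  (forall g e, (e < B)%N -> (h * esym_gen T * g)`_e = (hS * g)`_e) ->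
  (forall g e, (e < B)%N -> (h * esym_gen S * g)`_e = (hT * g)`_e) ->
  (forall i, (i < N)%N -> (nth 0%N d i < B)%N) ->
  vdm Y * jacobi_trudi N (h * esym_gen Y) d * delta2 S T =
  \sum_(A : {set 'I_m}) \sum_(M : {set 'I_N} | (#|A| + #|M|)%N == l)
    let U := at_pos 0 Y (pos A) in
    let V := at_pos 0 Y (pos (~: A)) in
    let dM := at_pos 0%N d (pos M) in
    (-1) ^+ (inversions (pos A) (pos (~: A)) + inversions (pos M) (pos (~: M))
             + size (pos M) * size (pos (~: A))) *
    (delta2 U T * vdm U *
      (if all (leq t) dM then jacobi_trudi (size (pos M)) (hS * esym_gen U) (map (subn^~ t) dM)
        else 0)) *
    (delta2 V S * vdm V * jacobi_trudi (size (pos (~: M))) (hT * esym_gen V) (at_pos 0%N d (pos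
      (~: M)))).
Proof.
move=> sY sS; subst m l; set m := size Y; set l := size S; set K := (m + N)%N => t leK hST hSS ltB.
rewrite -fdet_mixed_mx -/m -/K -(fdet_sylvester leK) -fdet_mul -/l.
pose r := (K - l)%N.
have EK : K = (l + r)%N by rewrite /r; lia.
(* The functionals applied to the new basis. The summand [0] gives the second block the shape
   required by [fdet_minor], with [t = 0]. *)
pose F i j : R := if (j < l)%N then
    (if (i < m)%N then (root_poly T).[Y`_i] * Y`_i ^+ j
     else (hS * 'X^(t + (l - j.+1)))`_(nth 0%N d (i - m)))
  else (if (i < m)%N then (root_poly S).[Y`_i] * Y`_i ^+ (j - l)
     else (hT * 'X^(0 + (r - (j - l).+1)))`_(nth 0%N d (i - m))).
transitivity (fdet K F).
  apply: eq_fdet => i j lti ltj.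
  rewrite sum_mixed_mx; last first.
    case: (ltnP j l) => lej; last first.
      rewrite (leq_trans (size_root_polyM (K := r) _ _)) ?size_polyXn ?EK //; rewrite /r; lia.
    rewrite (leq_trans (size_root_polyM (K := (K - size T)%N) _ _)) ?size_polyXn //;
      rewrite /t; lia.
  rewrite /F -/m; case: (ltnP i m) => lei; case: (ltnP j l) => lej.
  - by rewrite hornerM hornerXn.
  - by rewrite hornerM hornerXn.
  - have -> : K = (size T + (K - size T))%N by lia.
    rewrite reverse_poly_root_poly ?size_polyXn ?reverse_polyX; try lia.
    rewrite mulrA hST; last by apply: ltB; lia.
    by congr ((_ * 'X^_)`_ _); rewrite /t; lia.
  - rewrite {1}EK reverse_poly_root_poly ?size_polyXn ?reverse_polyX /r; try lia.
    by rewrite mulrA hSS // ltB //; lia.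
(* [K] is [m + N], and equals [l + r] only propositionally; the size is generalized so that the
   subsets can still be split along [m + N]. *)
have lap (K' : nat) : K' = (l + r)%N -> fdet K' F = \sum_(I : {set 'I_K'} | #|I| == l)
    (-1) ^+ inversions (pos I) (pos (~: I)) *
    fdet l (fun i j => F (nth 0%N (pos I) i) j) *
    fdet r (fun i j => F (nth 0%N (pos (~: I)) i) (l + j)%N).
  by move=> ->; apply: laplace.
rewrite (lap _ EK) /K.
rewrite (@sum_join _ m N l (fun p q => (-1) ^+ inversions p q *
    fdet l (fun i j => F (nth 0%N p i) j) * fdet r (fun i j => F (nth 0%N q i) (l + j)%N))).
apply: eq_bigr => A _; apply: eq_bigr => M /eqP cAM /=.
have delta2E s X : delta2 X s = \prod_(y <- X) (root_poly s).[y].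
  by apply: eq_bigr => y _; rewrite root_poly_horner.
rewrite inversions_join ?all_pos //; congr (_ * _ * _).
  rewrite delta2E -(@fdet_minor _ _ _ _ _ m _ l) ?all_pos ?size_pos //.
  by apply: eq_fdet => i j lti ltj; rewrite /F ltj.
have cC : (#|~: A| + #|~: M|)%N = r.
  by have := cardsC A; have := cardsC M; rewrite !card_ord; lia.
have := @fdet_minor _ Y hT (root_poly S) d m 0 r (pos (~: A)) (pos (~: M)).
rewrite [(size _ + _)%N](_ : _ = r) ?size_pos // => /(_ erefl (all_pos _)); rewrite -delta2E.
have -> : all (leq 0) (at_pos 0%N d (pos (~: M))) by apply/allP.
have -> : map (subn^~ 0%N) (at_pos 0%N d (pos (~: M))) = at_pos 0%N d (pos (~: M)).
  by rewrite -[RHS]map_id; apply: eq_map => x; rewrite subn0.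
move=> <-; apply: eq_fdet => i j lti ltj.
by rewrite /F ltnNge leq_addr /= addKn.
Qed.

(** * The Jacobi-Trudi formula and its dual *)

Lemma nth_add_rho N la i : (i < N)%N -> nth 0%N (add_rho N la) i = (nth 0 la i + (N - i.+1))%N.
Proof. by move=> lt; rewrite nth_mkseq. Qed.

Lemma fdet_tr (R : comNzRingType) n (F : nat -> nat -> R) : fdet n F = fdet n (fun i j => F j i).
Proof. by rewrite /fdet -det_tr; congr (\det _); apply/matrixP => i j; rewrite !mxE. Qed.

(** If the last part is 0, the last row is [(0, ..., 0, 1)]; in the remaining minor one factor ['X]
    cancels against the shift of [rho]. *)
Lemma jacobi_trudi_addS (R : comNzRingType) N (h : {poly R}) la : h`_0 = 1 -> nth 0%N la N = 0%N ->
  jacobi_trudi N.+1 h (add_rho N.+1 la) = jacobi_trudi N h (add_rho N la).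
Proof.
move=> h0 la0; rewrite /jacobi_trudi -addn1 fdet_tr fdet_block; last first.
  move=> i j lti ltj; have -> : j = 0%N by lia.
  rewrite addn0 nth_add_rho ?addn1 // la0 subnn coefMXn.
  by have -> : (0 < N.+1 - i.+1)%N by lia.
have -> : fdet 1 (fun i j => (h * 'X^(N + 1 - (N + i).+1))`_(nth 0%N (add_rho (N + 1) la) (N +
  j))) = 1.
  rewrite /fdet det_mx11 mxE !addn0 nth_add_rho ?addn1 //.
  by rewrite la0 subnn expr0 mulr1 h0.
rewrite mulr1 [RHS]fdet_tr; apply: eq_fdet => i j lti ltj.
rewrite !nth_add_rho ?ltn_addr //.
have -> : (N + 1 - i.+1 = (N - i.+1) + 1)%N by lia.
have -> : (nth 0 la j + (N + 1 - j.+1) = (nth 0 la j + (N - j.+1)).+1)%N by lia.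
by rewrite addn1 exprSr mulrA coefMX.
Qed.

Lemma jacobi_trudi_stable (R : comNzRingType) N N' (h : {poly R}) la : h`_0 = 1 -> is_part la ->
  (part_length la <= N)%N -> (N <= N')%N ->
  jacobi_trudi N' h (add_rho N' la) = jacobi_trudi N h (add_rho N la).
Proof.
move=> h0 pl le leN; rewrite -(subnKC leN); elim: (N' - N)%N => [|k IH]; first by rewrite addn0.
by rewrite addnS jacobi_trudi_addS ?IH // part_length_nth // (leq_trans le) // leq_addr.
Qed.

Lemma jacobi_trudi_rho (R : comNzRingType) N (h : {poly R}) : h`_0 =
  1 -> jacobi_trudi N h (add_rho N [::]) = 1.
Proof. by move=> h0; rewrite (@jacobi_trudi_stable _ 0) // /jacobi_trudi /fdet det_mx00. Qed.

Lemma jacobi_trudi_map (R S : comNzRingType) (f : {rmorphism R -> S}) N h d :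
  f (jacobi_trudi N h d) = jacobi_trudi N (map_poly f h) d.
Proof.
rewrite /jacobi_trudi /fdet -det_map_mx; congr (\det _); apply/matrixP => i j.
by rewrite !mxE -coef_map rmorphM /= map_polyXn.
Qed.

(** In each nonzero term of the determinant the extracted indices are nonnegative and sum to the
    size of [la], so none of them exceeds it. *)
Lemma jacobi_trudi_ext (R : comNzRingType) N (h h' : {poly R}) la :
  (forall r, (r <= \sum_(i < N) nth 0 la i)%N -> h`_r = h'`_r) ->
  jacobi_trudi N h (add_rho N la) = jacobi_trudi N h' (add_rho N la).
Proof.
move=> Eh; rewrite /jacobi_trudi /fdet /determinant; apply: eq_bigr => s _; congr (_ * _).
case: (boolP [exists i : 'I_N, nth 0 la i + (N - i.+1) < N - (s i).+1]%N).
  move/existsP => [i lt]; rewrite (bigD1 i) //= [RHS](bigD1 i) //= !mxE.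
  by rewrite !nth_add_rho // !coefMXn lt !mul0r.
move/existsPn => ge; apply: eq_bigr => i _.
rewrite !mxE !nth_add_rho // !coefMXn (negbTE (ge i)); apply: Eh.
pose e (i : 'I_N) := (nth 0 la i + (N - i.+1) - (N - (s i).+1))%N.
suff -> : (\sum_(i < N) nth 0 la i = \sum_i e i)%N by rewrite (bigD1 i) //= leq_addr.
have : (\sum_i (e i + (N - (s i).+1)) = \sum_(i < N) (nth 0 la i + (N - i.+1)))%N.
  by apply: eq_bigr => j _; rewrite subnK // leqNgt.
rewrite !big_split /=.
have -> : (\sum_(i < N) (N - (s i).+1) = \sum_(i < N) (N - i.+1))%N.
  by rewrite [RHS](reindex_inj (@perm_inj _ s)).
by move/addIn.
Qed.

(* Only the coefficients of degree less than [B] are complete symmetric functions. *)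
Definition hsym_gen (R : comNzRingType) B (X : seq R) : {poly R} :=
  \prod_(x <- X) \poly_(i < B) x ^+ i.

Lemma geometric_telescope (R : comNzRingType) B (x : R) :
  (\poly_(i < B) x ^+ i) * (1 - x *: 'X) = 1 - x ^+ B *: 'X^B.
Proof.
rewrite poly_def; elim: B => [|B IH]; first by rewrite big_ord0 mul0r !expr0 scale1r subrr.
rewrite big_ord_recr mulrDl IH /= !exprS -!mul_polyC polyCM.
by ring.
Qed.

(** Each [x] in [T] contributes [1 - x^B 'X^B] after telescoping, which acts as 1 on coefficients
    below [B]. *)
Lemma hsym_gen_catM (R : comNzRingType) B (S T : seq R) g e : (e < B)%N ->
  (hsym_gen B (S ++ T) * esym_gen T * g)`_e = (hsym_gen B S * g)`_e.
Proof.
move=> lt; rewrite /hsym_gen big_cat /esym_gen /= -mulrA -mulrA [_ * (_ * g)]mulrA -big_split /=.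
rewrite mulrCA; elim: T => [|x T IH]; first by rewrite big_nil mul1r.
rewrite big_cons geometric_telescope -mulrA mulrBl mul1r coefB IH.
by rewrite -scalerAl coefZ coefXnM lt mulr0 subr0.
Qed.

Lemma hsym_gen_perm (R : comNzRingType) B (S T : seq R) : perm_eq S T -> hsym_gen B S =
  hsym_gen B T.
Proof. exact: perm_big. Qed.

Lemma hsym_gen_esym_gen (R : comNzRingType) B (T : seq R) e : (e < B)%N ->
  (hsym_gen B T * esym_gen T)`_e = (1 : {poly R})`_e.
Proof.
by move=> lt; have := hsym_gen_catM [::] T 1 lt; rewrite /= !mulr1 => ->; rewrite /hsym_gen big_nil.
Qed.

Lemma hsym_gen0 (R : comNzRingType) B (X : seq R) : (0 < B)%N -> (hsym_gen B X)`_0 = 1.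
Proof.
move=> B0; elim: X => [|x X IH]; rewrite /hsym_gen ?big_nil ?coef1 // big_cons.
by rewrite -/(hsym_gen B X) coef0M IH coef_poly B0 expr0 mulr1.
Qed.

Lemma esym_gen0 (R : comNzRingType) (X : seq R) : (esym_gen X)`_0 = 1.
Proof.
elim: X => [|x X IH]; rewrite /esym_gen ?big_nil ?coef1 // big_cons -/(esym_gen X).
by rewrite coef0M IH coefB coef1 coefZ coefX mulr0 subr0 mulr1.
Qed.

Lemma hsym_gen_ext (R : comNzRingType) B B' (X : seq R) e : (e < B)%N -> (B <= B')%N ->
  (hsym_gen B X)`_e = (hsym_gen B' X)`_e.
Proof.
move=> lt le; elim: X e lt => [|x X IH] e lt; first by rewrite /hsym_gen !big_nil.
rewrite /hsym_gen !big_cons !coefM; apply: eq_bigr => i _.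
have lte : (e - i < B)%N by exact: leq_ltn_trans (leq_subr _ _) lt.
have lti : (i < B)%N by exact: leq_ltn_trans (leq_ord i) lt.
by rewrite -!/(hsym_gen _ _) !coef_poly IH // lti (leq_trans lti).
Qed.

Lemma size_esym_gen (R : comNzRingType) (X : seq R) : (size (esym_gen X) <= (size X).+1)%N.
Proof.
elim: X => [|x X IH]; rewrite /esym_gen ?big_nil ?size_poly1 // big_cons -/(esym_gen X).
apply: leq_trans (size_polyMleq _ _) _.
have : (size (1 - x *: 'X : {poly R})%R <= 2)%N.
  rewrite (leq_trans (size_polyD _ _)) // geq_max size_poly1 size_polyN /=.
  by rewrite (leq_trans (size_scale_leq _ _)) ?size_polyX.
by move: IH; rewrite /=; lia.
Qed.

Lemma map_hsym_gen (R S : comNzRingType) (f : {rmorphism R -> S}) B X :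
  map_poly f (hsym_gen B X) = hsym_gen B (map f X).
Proof.
rewrite /hsym_gen rmorph_prod big_map; apply: eq_bigr => x _.
apply/polyP => i; rewrite coef_map !coef_poly; case: ifP => _; [exact: rmorphXn | exact: rmorph0].
Qed.

Lemma map_esym_gen (R S : comNzRingType) (f : {rmorphism R -> S}) X :
  map_poly f (esym_gen X) = esym_gen (map f X).
Proof.
rewrite /esym_gen rmorph_prod big_map; apply: eq_bigr => x _.
by rewrite rmorphB rmorph1 /= map_polyZ /= map_polyX.
Qed.

(* [hsym_gen B X] inverts [esym_gen X] modulo ['X^B], so the reversed coefficients of
   [esym_gen X] form a kernel vector of the Jacobi-Trudi matrix. *)
Lemma jacobi_trudi_hsym_gen_eq0 (R : comNzRingType) N B (X : seq R) (d : seq nat) :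
  (size X < N)%N -> (forall i, (i < N)%N -> (0 < nth 0%N d i < B)%N) ->
  jacobi_trudi N (hsym_gen B X) d = 0.
Proof.
move=> ltN d0; rewrite /jacobi_trudi /fdet; set M := \matrix_(_, _) _.
pose v : 'cV[R]_N := \col_c (esym_gen X)`_(N - c.+1).
have Mv : M *m v = 0.
  apply/matrixP => i j; rewrite !mxE.
  have /andP[di0 diB] := d0 i (ltn_ord i).
  transitivity (hsym_gen B X * esym_gen X)`_(nth 0%N d i).
    have -> : esym_gen X = \sum_(c < N) (esym_gen X)`_(N - c.+1) *: 'X^(N - c.+1).
      rewrite (reindex_inj rev_ord_inj) /=.
      have Ek (c : 'I_N) : (N - (N - c.+1).+1 = c)%N by have := ltn_ord c; lia.
      under eq_bigr do rewrite Ek.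
      rewrite -poly_def; apply/polyP => c; rewrite coef_poly; case: ltnP => // le.
      by rewrite nth_default // (leq_trans (size_esym_gen X)) ?(leq_trans ltN).
    rewrite mulr_sumr coef_sum; apply: eq_bigr => c _.
    by rewrite !mxE -scalerAr coefZ mulrC.
  by rewrite hsym_gen_esym_gen // coef1 gtn_eqF.
have N0 : (0 < N)%N by lia.
have lt : (N.-1 < N)%N by lia.
(* Over a ring a kernel vector yields only [\det M] times [v] equal to 0; the last entry of [v] is
   the constant coefficient 1 of [esym_gen X]. *)
have := congr1 (fun A => (\adj M *m A) (Ordinal lt) 0) Mv.
rewrite mulmxA mul_adj_mx mulmx0 mul_scalar_mx !mxE /=.
by rewrite prednK // subnn esym_gen0 mulr1.
Qed.

(** * Alternants, conjugation and Schur polynomials as determinants *)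

Lemma fdet_rev (R : comNzRingType) n (F : nat -> nat -> R) :
  fdet n (fun i j => F (n - i.+1)%N (n - j.+1)%N) = fdet n F.
Proof.
pose s : 'S_n := perm rev_ord_inj; set M := \matrix_(i < n, j < n) F i j.
transitivity (\det (row_perm s (col_perm s M))).
  by congr (\det _); apply/matrixP => i j; rewrite !mxE !permE.
rewrite row_permE col_permE !det_mulmx !det_perm odd_permV mulrCA.
by rewrite -expr2 sqrr_sign mulr1.
Qed.

Lemma alternant_fdet n (al : nat -> nat) :
  alternant (fun j : 'I_n => al j) =
  fdet n (fun i j => nth 0 [seq 'X_i | i <- enum 'I_n] i ^+ al j) :> {mpoly int[n]}.
Proof.
congr (\det _); apply/matrixP => i j.
by rewrite !mxE (nth_map i) ?size_enum_ord // nth_ord_enum.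
Qed.

Lemma vandermonde_rho n : vandermonde n = alternant (rho_exp [::]) :> {mpoly int[n]}.
Proof.
set X : seq {mpoly int[n]} := [seq 'X_i | i <- enum 'I_n].
have nX (i : 'I_n) : X`_i = 'X_i by rewrite (nth_map i) ?size_enum_ord // nth_ord_enum.
have sX : size X = n by rewrite size_map size_enum_ord.
transitivity (vdm (rev X)).
  rewrite (@vdm_nth _ _ n) ?size_rev //.
  rewrite /vandermonde (exchange_big_dep predT) //=.
  rewrite (reindex_inj rev_ord_inj); apply: eq_bigr => i _ /=.
  rewrite (reindex_inj rev_ord_inj); apply: eq_big => [j|j _] /=.
    by have := ltn_ord i; have := ltn_ord j; lia.
  by rewrite !nth_rev ?sX // -!nX.
rewrite -(@vdm_fdet _ _ n) ?size_rev // -fdet_rev.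
rewrite (alternant_fdet _ (fun j => nth 0 [::] j + (n - j.+1))%N); apply: eq_fdet => i j lti ltj.
rewrite nth_rev ?sX ?nth_nil ?add0n; last by lia.
by congr (_`_ _ ^+ _); lia.
Qed.

(* Multiplying the Jacobi-Trudi matrix by the coefficients of the products that omit
   one variable gives the alternant; the multiplier is identified by taking [la] empty. *)
Lemma jacobi_trudi_alternant n B la : (forall i, (i < n)%N -> nth 0%N (add_rho n la) i < B)%N ->
  (0 < B)%N -> (n <= B)%N ->
  alternant (rho_exp la) =
  jacobi_trudi n (hsym_gen B [seq 'X_i | i <- enum 'I_n]) (add_rho n la) * vandermonde n :>
    {mpoly int[n]}.
Proof.
set X : seq {mpoly int[n]} := [seq 'X_i | i <- enum 'I_n] => ltB B0 leB.
have sX : size X = n by rewrite size_map size_enum_ord.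
have EX : X = [seq X`_k | k <- iota 0 n].
  apply: (@eq_from_nth _ 0) => [|i]; rewrite sX ?size_map ?size_iota // => lti.
  by rewrite (nth_map 0%N) ?size_iota // nth_iota.
pose L j := [seq X`_k | k <- rem j (iota 0 n)].
pose p j := esym_gen (L j).
have pL j : (j < n)%N -> perm_eq X ([:: X`_j] ++ L j).
  move=> ltj; rewrite {1}EX -[_ ++ _]/(map (nth 0 X) (j :: rem j (iota 0 n))).
  by apply: perm_map; apply: perm_to_rem; rewrite mem_iota.
have key mu : (forall i, (i < n)%N -> nth 0%N (add_rho n mu) i < B)%N ->
    alternant (rho_exp mu) = jacobi_trudi n (hsym_gen B X) (add_rho n mu) * fdet n (fun c j =>
      (p j)`_(n - c.+1)).
  move=> {}ltB; rewrite (alternant_fdet _ (fun j => nth 0 mu j + (n - j.+1))%N) fdet_tr -fdet_mul.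
  apply: eq_fdet => i j lti ltj; rewrite -/X.
  have szp : (size (p j) <= n)%N.
    rewrite (leq_trans (size_esym_gen _)) // size_map size_rem ?mem_iota // size_iota.
    by rewrite prednK // (leq_ltn_trans _ ltj).
  transitivity (hsym_gen B X * p j)`_(nth 0%N (add_rho n mu) i); last first.
    have {1}-> : p j = \sum_(c < n) (p j)`_(n - c.+1) *: 'X^(n - c.+1).
      rewrite (reindex_inj rev_ord_inj) /=.
      have Ek (c : 'I_n) : (n - (n - c.+1).+1 = c)%N by have := ltn_ord c; lia.
      under eq_bigr do rewrite Ek.
      rewrite -poly_def; apply/polyP => c; rewrite coef_poly; case: ltnP => // le.
      by rewrite nth_default // (leq_trans szp).
    rewrite mulr_sumr coef_sum; apply: eq_bigr => c _.
    by rewrite -scalerAr coefZ mulrC.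
  rewrite (hsym_gen_perm _ (pL j ltj)) /p -[_ * esym_gen _]mulr1 hsym_gen_catM ?ltB // mulr1.
  by rewrite /hsym_gen big_seq1 coef_poly ltB // nth_add_rho.
rewrite (key la ltB); congr (_ * _).
rewrite vandermonde_rho (key [::]) ?jacobi_trudi_rho ?mul1r ?hsym_gen0 // => i lti.
by rewrite nth_add_rho // nth_nil; lia.
Qed.

Lemma count_part_gt la b j : is_part la ->
  (j < count (fun x => b < x)%N la)%N = (b < nth 0 la j)%N.
Proof.
rewrite /is_part; elim: la j => [|x la IH] j; first by rewrite nth_nil.
rewrite /= (path_sortedE (rev_trans leq_trans)) => /andP[ax so].
case: (ltnP b x) => [ltb|leb]; first by case: j => [|j] //=; rewrite add1n ltnS IH.
have -> : count (fun y => b < y)%N la = 0%N.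
  by apply/eqP; rewrite -leqn0 leqNgt -has_count; apply/hasPn => y /(allP ax) /= le;
    rewrite -leqNgt (leq_trans le).
case: j => [|j] /=; first by apply/esym/negbTE; rewrite -leqNgt.
apply/esym/negbTE; rewrite -leqNgt; case: (ltnP j (size la)) => lt; last by rewrite nth_default.
by rewrite (leq_trans _ leb) //; apply: (allP ax); rewrite mem_nth.
Qed.

(** By stability the determinant may be taken of size [part_length la], where all entries of
    [la + rho] are positive, as needed for its vanishing in fewer variables, or of size [n], where
    the quotient of alternants applies. *)
Lemma schur_poly_jacobi_trudi n N B la : is_part la -> (part_length la <= N)%N -> (sumn la < B)%N ->
  schur_poly n la = jacobi_trudi N (hsym_gen B [seq 'X_i | i <- enum 'I_n]) (add_rho N la).
Proof.
move=> pl leN ltB; set X := map _ _.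
have sX : size X = n by rewrite size_map size_enum_ord.
pose B' := (B + n + sumn la)%N.
have B'0 : (0 < B')%N by rewrite /B'; lia.
have nth_le i : (nth 0 la i <= sumn la)%N.
  elim: (la) i => [|x s IH] [|i] //=; first exact: leq_addr.
  exact: leq_trans (IH i) (leq_addl _ _).
have -> : jacobi_trudi N (hsym_gen B X) (add_rho N la) =
  jacobi_trudi (part_length la) (hsym_gen B' X) (add_rho (part_length la) la).
  rewrite -(jacobi_trudi_stable (hsym_gen0 _ B'0) pl (leqnn _) leN).
  apply: jacobi_trudi_ext => r; rewrite sum_nth_part // => le; apply: hsym_gen_ext;
    rewrite ?/B'; lia.
case: (leqP (part_length la) n) => len; last first.
  rewrite /schur_poly leqNgt len /= jacobi_trudi_hsym_gen_eq0 ?sX // => i lti.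
  rewrite nth_add_rho // addn_gt0 -count_part_gt // lti /= /B'.
  have := nth_le i; have := part_length_sumn la; lia.
apply: (mulIf (vandermonde_neq0 n)); rewrite schur_polyE // (@jacobi_trudi_alternant n B') /B';
  try lia.
  by rewrite (jacobi_trudi_stable (hsym_gen0 _ B'0) pl (leqnn _) len).
move=> i lti; rewrite nth_add_rho //; have := nth_le i; lia.
Qed.

Lemma count_ord_nth (la : seq nat) (p : pred nat) N : ~~ p 0%N -> is_part la ->
  (part_length la <= N)%N -> count p la = (\sum_(j < N) p (nth 0 la j))%N.
Proof.
move=> p0 pl leN; pose M := maxn N (size la).
have -> : (\sum_(j < N) p (nth 0%N la j) = \sum_(j < M) p (nth 0%N la j))%N.
  rewrite (big_ord_widen M (fun j => p (nth 0%N la j) : nat)) ?leq_maxl // big_mkcond.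
  apply: eq_bigr => j _; case: ltnP => // le.
  by rewrite part_length_nth ?(negbTE p0) // (leq_trans leN).
have : (size la <= M)%N by rewrite leq_maxr.
elim: (la) M {pl leN} => [|x s IH] M /= le.
  by rewrite big1 // => j _; rewrite nth_nil (negbTE p0).
by case: M le => // M le; rewrite big_ord_recl /= -(IH M).
Qed.

Lemma nth_conj_part la b : is_part la ->
  nth 0%N (conj_part la) b = count (fun x => b < x)%N la.
Proof.
move=> pl; case: (ltnP b (head 0%N la)) => [lt|le]; first by rewrite nth_mkseq.
rewrite nth_default ?size_mkseq //; apply/esym/eqP.
by rewrite -leqn0 leqNgt count_part_gt // -leqNgt nth0.
Qed.

Lemma part_length_conj la : is_part la -> part_length (conj_part la) = head 0%N la.
Proof.
move=> pl; rewrite /part_length -[RHS](size_mkseq (fun i => count (fun x => i < x)%N la)).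
apply/eqP; rewrite -all_count; apply/(all_nthP 0%N) => b; rewrite size_mkseq => lt.
by rewrite nth_conj_part // count_part_gt // nth0.
Qed.

Lemma fdet_rev_rows (R : comNzRingType) n : exists b : bool, forall F : nat -> nat -> R,
  fdet n (fun i j => F (n - i.+1)%N j) = (-1) ^+ b * fdet n F.
Proof.
exists (perm (@rev_ord_inj n) : bool) => F; rewrite -det_perm -det_mulmx -row_permE.
by congr (\det _); apply/matrixP => i j; rewrite !mxE !permE.
Qed.

Lemma nth_part_le_head la j : is_part la -> (nth 0 la j <= head 0 la)%N.
Proof.
move=> pl; rewrite leqNgt -count_part_gt // -leqNgt (leq_trans _ (leq0n j)) //.
by rewrite leqNgt count_part_gt // nth0 ltnn.
Qed.

(* Macdonald's description of the complement of [nu + rho] in an initial segment. *)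
Lemma conj_complement m N nu : is_part nu -> (part_length nu <= N)%N -> (head 0 nu <= m)%N ->
  let c := mkseq (fun i => nth 0 (conj_part nu) (m - i.+1) + i)%N m in
  let e := mkseq (fun j => m + j - nth 0 nu j)%N N in
  [/\ sorted ltn c, sorted ltn e, perm_eq (iota 0 (m + N)) (c ++ e)
    & inversions c e = (\sum_(b < m) nth 0 (conj_part nu) b)%N].
Proof.
move=> pn leN lem c e; set cj := conj_part nu.
have nu_le j : (nth 0 nu j <= m)%N by rewrite (leq_trans _ lem) ?nth_part_le_head.
have cj_lt b j : (j < nth 0 cj b)%N = (b < nth 0 nu j)%N.
  by rewrite nth_conj_part // count_part_gt.
have cj_le b : (nth 0 cj b <= N)%N.
  by rewrite leqNgt cj_lt part_length_nth.
have nu_mono j : (nth 0 nu j.+1 <= nth 0 nu j)%N.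
  by rewrite leqNgt; apply/negP; rewrite -count_part_gt // => /ltnW; rewrite count_part_gt // ltnn.
have cj_mono b : (nth 0 cj b.+1 <= nth 0 cj b)%N.
  rewrite leqNgt cj_lt; apply/negP => lt.
  by have := cj_lt b (nth 0%N cj b); rewrite ltnn (ltn_trans _ lt).
have cE i : (i < m)%N -> nth 0%N c i = (nth 0 cj (m - i.+1) + i)%N by exact: nth_mkseq.
have eE j : (j < N)%N -> nth 0%N e j = (m + j - nth 0 nu j)%N by exact: nth_mkseq.
have sc : sorted ltn c.
  apply/(sortedP 0%N) => i; rewrite size_mkseq => lti.
  rewrite !cE //; last exact: ltnW.
  have -> : (m - i.+1 = (m - i.+2).+1)%N by lia.
  by have := cj_mono (m - i.+2)%N; rewrite /ltn /=; lia.
have se : sorted ltn e.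
  apply/(sortedP 0%N) => j; rewrite size_mkseq => ltj.
  rewrite !eE //; last exact: ltnW.
  by have := nu_mono j; have := nu_le j; rewrite /ltn /=; lia.
have cmp i j : (i < m)%N -> (m + j - nth 0 nu j < nth 0 cj (m - i.+1) + i)%N =
  (m - i.+1 < nth 0 nu j)%N
   /\ (m + j - nth 0 nu j != nth 0 cj (m - i.+1) + i)%N.
  move=> lti; have := cj_lt (m - i.+1)%N j; have := nu_le j.
  by case: (ltnP j (nth 0%N cj (m - i.+1))) => le1 le2 /esym le3; split; lia.
split=> //.
- have uq : uniq (c ++ e).
    rewrite cat_uniq !(sorted_uniq ltn_trans ltnn) // andbT /=.
    apply/hasPn => _ /mapP[j _ ->]; apply/negP => /mapP[i]; rewrite mem_iota => lti Eq.
    by have [_ /eqP] := cmp i j lti; apply.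
  have sub : {subset c ++ e <= iota 0 (m + N)}.
    move=> x; rewrite mem_cat mem_iota add0n => /orP[] /mapP[i]; rewrite mem_iota add0n => lti ->.
      by have := cj_le (m - i.+1)%N; rewrite -/cj; lia.
    by have := nu_le i; lia.
  have [|_ eqm] := uniq_min_size uq sub.
    by rewrite size_cat !size_mkseq size_iota.
  by apply: uniq_perm; rewrite ?iota_uniq // => x; rewrite eqm.
(* With [b = m - i - 1], the pair of [c_i] and [e_j] is an inversion exactly when [b < nu_j], so
   inversions are the cells of the diagram. *)
- rewrite /inversions big_map -[m in iota 0 m]subn0 big_mkord (reindex_inj rev_ord_inj) /=.
  apply: eq_bigr => b _; rewrite big_map -[N in iota 0 N]subn0 big_mkord [RHS](nth_conj_part _ pn).
  rewrite [RHS](@count_ord_nth _ _ N) //; apply: eq_bigr => j _.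
  rewrite -/cj.
  have ltb : (m - b.+1 < m)%N by have := ltn_ord b; lia.
  have [-> _] := cmp _ j ltb.
  by congr (nat_of_bool (_ < _)%N); have := ltn_ord b; lia.
Qed.

(* Apply [fdet_mixed_mx] to [h = 1]: the coefficient rows are then unit vectors, and the
   columns that they leave are given by [conj_complement].  The signs cancel because they
   do so for the empty partition. *)
Lemma schur_poly_conj m N nu : is_part nu -> (part_length nu <= N)%N ->
  schur_poly m (conj_part nu) =
  jacobi_trudi N (esym_gen [seq - x | x <- [seq 'X_i | i <- enum 'I_m]]) (add_rho N nu).
Proof.
set X : seq {mpoly int[m]} := [seq 'X_i | i <- enum 'I_m].
set Y := [seq - x | x <- X] => pn leN.
have sX : size X = m by rewrite size_map size_enum_ord.
have nX (i : 'I_m) : X`_i = 'X_i by rewrite (nth_map i) ?size_enum_ord // nth_ord_enum.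
have sY : size Y = m by rewrite size_map.
have vY : vdm Y = vandermonde m.
  rewrite (vdm_nth sY) /vandermonde; apply: eq_bigr => i _; apply: eq_bigr => j _.
  by rewrite !(nth_map 0) ?sX // !nX opprK addrC.
have W mu : vandermonde m * jacobi_trudi N (esym_gen Y) (add_rho N mu) =
    fdet (m + N) (mixed_mx (m + N) Y 1 (add_rho N mu)).
  by rewrite -vY -[m in fdet (m + N)]sY -[m in mixed_mx (m + N)]sY fdet_mixed_mx mul1r.
case: (leqP (head 0%N nu) m) => lem; last first.
  rewrite /schur_poly part_length_conj // leqNgt lem /=.
  apply/esym/eqP; rewrite -(mulrI_eq0 _ (mulfI (vandermonde_neq0 m))) W; apply/eqP.
  have N0 : (0 < N)%N.
    by apply: leq_trans leN; rewrite /part_length count_part_gt // nth0 (leq_trans _ lem).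
  (* The first extraction row has index [nu_0 + N - 1 >= m + N], beyond all [m + N] columns. *)
  apply: (@fdet_row0 _ _ _ m) => [|j ltj]; first by lia.
  rewrite /mixed_mx sY ltnn subnn mul1r coefXn nth_add_rho // nth0.
  by case: eqP => //; lia.
have [b revE] := fdet_rev_rows {mpoly int[m]} m.
have key mu : is_part mu -> (part_length mu <= N)%N -> (head 0 mu <= m)%N ->
    vandermonde m * jacobi_trudi N (esym_gen Y) (add_rho N mu) =
    (-1) ^+ (b + \sum_(i < m) i)%N * alternant (rho_exp (conj_part mu)).
  move=> {nu pn leN lem} pm leN lem; rewrite W.
  have [sc se pe iE] := conj_complement pm leN lem; set c := mkseq _ _ in sc pe iE *.
  set e := mkseq _ _ in se pe iE.
  rewrite fdet_tr; set F := fun i j => _.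
  transitivity (fdet (m + N) (fun i j => F (nth 0%N (iota 0 (m + N)) i) j)).
    by apply: eq_fdet => i j lti _; rewrite nth_iota.
  rewrite (fdet_shuffle F sc se (iota_ltn_sorted _ _) pe) ?size_iota // iE.
  have ue : uniq (c ++ e) by rewrite -(perm_uniq pe) iota_uniq.
  have ltK x : x \in c ++ e -> (x < m + N)%N by rewrite -(perm_mem pe) mem_iota.
  have szc : size c = m by rewrite size_mkseq.
  have sze : size e = N by rewrite size_mkseq.
  have cE i : (i < m)%N -> nth 0%N c i =
    (nth 0 (conj_part mu) (m - i.+1) + i)%N by exact: nth_mkseq.
  have eE j : (j < N)%N -> nth 0%N e j = (m + j - nth 0 mu j)%N by exact: nth_mkseq.
  have Fe x j : x \in c ++ e -> (j < N)%N -> F x (m + j)%N = (x == nth 0%N e j)%:R.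
    move=> /ltK ltx ltj; rewrite /F /mixed_mx sY ltnNge leq_addr /= addKn mul1r coefXn.
    rewrite nth_add_rho // eE //; congr (nat_of_bool _)%:R.
    by have := nth_part_le_head j pm; lia.
  have ci i : (i < m)%N -> nth 0%N c i \in c ++ e.
    by move=> lt; rewrite mem_cat mem_nth // szc.
  have ei i : (i < N)%N -> nth 0%N e i \in c ++ e.
    by move=> lt; rewrite mem_cat orbC mem_nth // sze.
  rewrite fdet_block; last first.
    move=> i j lti ltj; rewrite nth_cat szc lti Fe ?ci //.
    move: ue; rewrite cat_uniq => /and3P[_ /hasPn/(_ (nth 0%N e j)) h _].
    case: eqP => // E; have {}h := h (mem_nth _ _); move: h; rewrite sze => /(_ ltj).
    by rewrite -E /= mem_nth // szc.
  have -> : fdet N (fun i j => F (nth 0%N (c ++ e) (m + i)) (m + j)%N) = 1.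
    have Ed i j : (i < N)%N -> (j < N)%N -> F (nth 0%N (c ++ e) (m + i)) (m + j)%N = (i == j)%:R.
      move=> lti ltj; rewrite nth_cat szc ltnNge leq_addr /= addKn Fe ?ei //.
      by rewrite nth_uniq ?sze // (sorted_uniq ltn_trans ltnn).
    rewrite fdet_upper => [|i j lt lti]; last by rewrite Ed ?gtn_eqF // (ltn_trans lt).
    by rewrite big1 // => i _; rewrite Ed // eqxx.
  rewrite mulr1.
  pose G i j : {mpoly int[m]} := X`_j ^+ (nth 0 (conj_part mu) i + (m - i.+1))%N.
  have -> : fdet m (fun i j => F (nth 0%N (c ++ e) i) j) =
      fdet m (fun i j => (-1) ^+ nth 0%N c i * G (m - i.+1)%N j).
    apply: eq_fdet => i j lti ltj.
    rewrite nth_cat szc lti /F /mixed_mx sY ltj /G (nth_map 0) ?sX // [LHS]exprNn cE //.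
    by congr (_ * X`_j ^+ (_ + _)); lia.
  rewrite (fdet_scale _ (fun i => (-1) ^+ nth 0%N c i) (fun i j => G (m - i.+1)%N j)) revE.
  have -> : fdet m G = alternant (rho_exp (conj_part mu)).
    by rewrite fdet_tr (alternant_fdet _ (fun j => nth 0 (conj_part mu) j + (m - j.+1))%N).
  (* These signs come from [Y = -X]. The part that depends on the partition equals the shuffle sign
     and cancels it. *)
  have -> : \prod_(i < m) (-1) ^+ nth 0%N c i = (-1) ^+ (\sum_(b0 < m) nth 0 (conj_part mu) b0)%N *
      (-1) ^+ (\sum_(i < m) i)%N :> {mpoly int[m]}.
    rewrite sign_prod -exprD; congr (_ ^+ _).
    rewrite (eq_bigr (fun i : 'I_m => nth 0 (conj_part mu) (m - i.+1) + i)%N); last first.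
      by move=> i _; apply: cE.
    rewrite big_split /=; congr (_ + _)%N.
    by rewrite [RHS](reindex_inj rev_ord_inj).
  by rewrite -mulrA signrMK mulrA -exprD addnC.
have := key [::] isT isT isT; rewrite jacobi_trudi_rho ?esym_gen0 // mulr1.
have -> : rho_exp (n := m) (conj_part [::]) = rho_exp [::] by [].
rewrite -vandermonde_rho => E1.
have := key nu pn leN lem; set eps := (-1) ^+ _ => E.
have eps1 : eps = 1.
  apply: (mulIf (vandermonde_neq0 m)); rewrite mul1r; exact/esym.
rewrite eps1 mul1r in E.
apply: (mulIf (vandermonde_neq0 m)); rewrite schur_polyE; last first.
  by rewrite part_length_conj.
by rewrite -E mulrC.
Qed.

(** * Littlewood-Schur functions as Jacobi-Trudi determinants *)

Definition sub_rho N (w : seq nat) : seq nat := mkseq (fun i => nth 0 w i - (N - i.+1))%N N.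

Lemma sub_rhoP N (w : seq nat) : sorted gtn w -> size w = N ->
  is_part (sub_rho N w) /\ add_rho N (sub_rho N w) = w.
Proof.
move=> so sz.
have lb i : (i < N)%N -> (N - i.+1 <= nth 0 w i)%N.
  by move=> lti; rewrite -{1}sz; apply: gtn_sorted_lb; rewrite ?sz.
split.
  apply/(sortedP 0%N) => i; rewrite size_mkseq => lti.
  rewrite !nth_mkseq //; last exact: ltnW.
  have := lb _ lti; have := lb _ (ltnW lti).
  have /(sortedP 0%N)/(_ i) := so; rewrite sz => /(_ lti) /=; rewrite /geq /=; lia.
apply: (@eq_from_nth _ 0%N); rewrite size_mkseq ?sz // => i lti.
by rewrite nth_add_rho // nth_mkseq // subnK ?lb.
Qed.

Lemma sub_add_rho N la : size la = N -> sub_rho N (add_rho N la) = la.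
Proof.
move=> sz; apply: (@eq_from_nth _ 0%N); rewrite size_mkseq ?sz // => i lti.
by rewrite nth_mkseq // nth_add_rho // addnK.
Qed.

Lemma gtn_sorted_eq (u v : seq nat) : sorted gtn u -> sorted gtn v -> u =i v -> u = v.
Proof.
apply: (@irr_sorted_eq _ gtn); last by move=> x; exact: ltnn.
by move=> y x z /= h1 h2; apply: ltn_trans h2 h1.
Qed.

Lemma rev_pos_sorted n (I : {set 'I_n}) : sorted gtn (rev (pos I)).
Proof. by rewrite rev_sorted pos_sorted. Qed.

Lemma size_vals a b (t : a.-tuple 'I_b) : size (vals t) = a.
Proof. by rewrite size_map size_tuple. Qed.

Lemma vals_inj a b : injective (@vals a b).
Proof. by move=> s t /(inj_map val_inj)/val_inj. Qed.

Definition inord_tuple a b (s : seq nat) : a.-tuple 'I_b.+1 :=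
  [tuple inord (nth 0%N s i) | i < a].

Lemma vals_inord_tuple a b s : size s = a -> all (leq^~ b) s -> vals (inord_tuple a b s) = s.
Proof.
move=> sz al; apply: (@eq_from_nth _ 0%N); rewrite size_vals ?sz // => i lti.
rewrite (nth_vals (inord_tuple a b s) (Ordinal lti)) tnth_mktuple inordK //.
by rewrite ltnS; apply: (allP al); rewrite mem_nth ?sz.
Qed.

Lemma part_all_le la b : is_part la -> (head 0 la <= b)%N -> all (leq^~ b) la.
Proof.
move=> pl le; apply/(all_nthP 0%N) => i lti.
by rewrite (leq_trans (nth_part_le_head i pl)).
Qed.

(** [mu + rho] runs over all strictly decreasing sequences of length [N] with values below [N + B];
    this turns the subsets of Cauchy-Binet into partitions. *)
Lemma sum_part (R : nmodType) N B (G : seq nat -> R) :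
  \sum_(mu : N.-tuple 'I_B.+1 | is_part (vals mu)) G (add_rho N (vals mu)) =
  \sum_(I : {set 'I_(N + B)} | #|I| == N) G (rev (pos I)).
Proof.
pose f (mu : N.-tuple 'I_B.+1) : {set 'I_(N + B)} :=
  [set k | val k \in add_rho N (vals mu)].
pose g (I : {set 'I_(N + B)}) : N.-tuple 'I_B.+1 := inord_tuple N B (sub_rho N (rev (pos I))).
have fE mu : is_part (vals mu) -> rev (pos (f mu)) = add_rho N (vals mu).
  move=> pm; apply: gtn_sorted_eq; first exact: rev_pos_sorted.
    by apply: add_rho_gtn; rewrite ?size_vals.
  move=> x; rewrite mem_rev; apply/mapP/idP => [[i]|xin].
    by rewrite mem_enum inE => ii ->.
  have ltx : (x < N + B)%N.
    have /mapP[i] := xin; rewrite mem_iota add0n => lti ->.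
    rewrite (nth_vals mu (Ordinal lti)); have := ltn_ord (tnth mu (Ordinal lti)); lia.
  by exists (Ordinal ltx); rewrite ?mem_enum ?inE.
have gE (I : {set 'I_(N + B)}) : #|I| = N -> is_part (vals (g I)) /\ add_rho N (vals (g I)) =
  rev (pos I).
  move=> cI; have sz : size (rev (pos I)) = N by rewrite size_rev size_pos.
  have [pg Eg] := sub_rhoP (rev_pos_sorted I) sz.
  suff -> : vals (g I) = sub_rho N (rev (pos I)) by [].
  apply: vals_inord_tuple; first by rewrite size_mkseq.
  apply: part_all_le => //; rewrite -nth0; case: (posnP N) => [N0|N0].
    by rewrite nth_default // size_mkseq N0.
  rewrite nth_mkseq //; have : nth 0%N (rev (pos I)) 0 \in rev (pos I) by rewrite mem_nth ?sz.
  by rewrite mem_rev => /mapP[x _ ->]; have := ltn_ord x; rewrite /=; lia.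
rewrite [RHS](reindex_onto f g) /=.
  apply: eq_big => [mu|mu pm]; last by rewrite fE.
  apply/idP/andP => [pm|[/eqP cf /eqP <-]]; last by case: (gE _ cf).
  have cf : #|f mu| = N by rewrite -size_pos -size_rev fE // size_mkseq.
  split; first exact/eqP.
  have [_ E] := gE _ cf; apply/eqP/vals_inj.
  by rewrite -[LHS](@sub_add_rho N) ?size_vals // E fE // sub_add_rho ?size_vals.
move=> I /eqP cI; have [pg Eg] := gE I cI.
by apply/setP => k; rewrite inE Eg mem_rev mem_pos.
Qed.

(** * Schur expansions and Littlewood-Richardson coefficients as monomial coefficients *)

Lemma map_fdet (R S : comNzRingType) (f : {rmorphism R -> S}) n (F : nat -> nat -> R) :
  f (fdet n F) = fdet n (fun i j => f (F i j)).
Proof. by rewrite /fdet -det_map_mx; congr (\det _); apply/matrixP => i j; rewrite !mxE. Qed.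

Definition genvars (R : comNzRingType) n : seq {mpoly R[n]} := [seq 'X_i | i <- enum 'I_n].

Definition intmp (R : comNzRingType) n (p : {mpoly int[n]}) : {mpoly R[n]} :=
  map_mpoly intr p.

Lemma nth_genvars (R : comNzRingType) n (i : 'I_n) : (genvars R n)`_i = 'X_i.
Proof. by rewrite (nth_map i) ?size_enum_ord // nth_ord_enum. Qed.

Lemma size_genvars (R : comNzRingType) n : size (genvars R n) = n.
Proof. by rewrite size_map size_enum_ord. Qed.

Lemma intmp_alternant (R : comNzRingType) n (al : nat -> nat) :
  intmp R (alternant (fun j : 'I_n => al j)) = fdet n (fun i j => (genvars R n)`_i ^+ al j).
Proof.
rewrite alternant_fdet /intmp map_fdet; apply: eq_fdet => i j lti ltj.
rewrite rmorphXn; congr (_ ^+ _).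
have /= -> := nth_genvars R (Ordinal lti); have /= -> := nth_genvars int (Ordinal lti).
exact: map_mpolyX.
Qed.

(* Cauchy-Binet for the factorization of [z_i^(rho_j) h(z_i)] into powers of [z_i] and
   coefficients of ['X^(rho_j) h]. *)
Lemma schur_expansion (R : comNzRingType) N B (h : {poly R}) : (size h <= B.+1)%N ->
  (\prod_(z <- genvars R N) (map_poly (@mpolyC N R) h).[z]) * intmp R (vandermonde N) =
  \sum_(mu : N.-tuple 'I_B.+1 | is_part (vals mu))
    (jacobi_trudi N h (add_rho N (vals mu)))%:MP * intmp R (alternant (rho_exp (vals mu))).
Proof.
move=> szh; set Z := genvars R N; have sZ : size Z = N by rewrite size_map size_enum_ord.
pose hC := map_poly (@mpolyC N R) h.
pose C e j : {mpoly R[N]} := ((h * 'X^(N - j.+1))`_e)%:MP.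
have -> : (\prod_(z <- Z) hC.[z]) * intmp R (vandermonde N) =
    fdet N (fun i j => \sum_(e < N + B) Z`_i ^+ e * C e j).
  rewrite vandermonde_rho (@intmp_alternant R N (fun j => nth 0 [::] j + (N - j.+1))%N).
  rewrite (big_nth 0) sZ big_mkord -(fdet_scale _ (fun i => hC.[Z`_i])).
  apply: eq_fdet => i j lti ltj; rewrite nth_nil add0n.
  have -> : hC.[Z`_i] * Z`_i ^+ (N - j.+1) = (map_poly (@mpolyC N R) (h * 'X^(N - j.+1))).[Z`_i].
    by rewrite rmorphM /= map_polyXn hornerM hornerXn.
  rewrite (@horner_coef_wide _ (N + B)); last first.
    rewrite (leq_trans (size_poly _ _)) // (leq_trans (size_polyMleq _ _)) //.
    by rewrite size_polyXn; move: (size h) szh => s; lia.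
  by apply: eq_bigr => e _; rewrite coef_map mulrC.
rewrite (cauchy_binet N (N + B) (fun i e => Z`_i ^+ e) C).
pose G w : {mpoly R[N]} := (jacobi_trudi N h w)%:MP * fdet N (fun i j => Z`_i ^+ nth 0%N w j).
(* Cauchy-Binet lists [I] increasingly, [mu + rho] decreasingly; both factors change by the same
   sign. *)
transitivity (\sum_(I : {set 'I_(N + B)} | #|I| == N) G (rev (pos I))).
  apply: eq_bigr => I /eqP cI; have [b revE] := fdet_rev_rows {mpoly R[N]} N.
  have szI : size (pos I) = N by rewrite size_pos.
  rewrite /G /jacobi_trudi map_fdet [X in _ = _ * X]fdet_tr.
  have -> : fdet N (fun i j => ((h * 'X^(N - j.+1))`_(nth 0%N (rev (pos I)) i))%:MP) =
      (-1) ^+ b * fdet N (fun i j => C (nth 0%N (pos I) i) j).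
    rewrite -revE; apply: eq_fdet => i j lti ltj; rewrite nth_rev ?szI //.
  have -> : fdet N (fun i j => Z`_j ^+ nth 0%N (rev (pos I)) i) =
      (-1) ^+ b * fdet N (fun i j => Z`_j ^+ nth 0%N (pos I) i).
    rewrite -revE; apply: eq_fdet => i j lti ltj; rewrite nth_rev ?szI //.
  by rewrite [X in X * _ = _]fdet_tr mulrACA -expr2 sqrr_sign mul1r mulrC.
rewrite -sum_part; apply: eq_bigr => mu _; rewrite /G; congr (_ * _).
rewrite (@intmp_alternant R N (fun j => nth 0 (vals mu) j + (N - j.+1))%N).
by apply: eq_fdet => i j lti ltj; rewrite nth_add_rho.
Qed.

Definition rho_mon n (la : seq nat) : 'X_{1..n} := [multinom rho_exp la i | i < n].

(** Both exponent vectors are strictly decreasing, so only the identity permutation can match them.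
    The coefficient at [la + rho] therefore isolates the alternant of [la]. *)
Lemma alternant_coef n ka la : is_part ka -> is_part la ->
  (alternant (n := n) (rho_exp ka))@_(rho_mon n la) =
  [forall i : 'I_n, nth 0%N ka i == nth 0%N la i]%:R.
Proof.
move=> pk pl; rewrite alternantE raddf_sum /=.
have mono mu i j : is_part mu -> (i < j)%N -> (j < n)%N ->
    (nth 0 mu j + (n - j.+1) < nth 0 mu i + (n - i.+1))%N.
  move=> pm ltij ltj; have : (nth 0 mu j <= nth 0 mu i)%N.
    rewrite leqNgt -count_part_gt // -leqNgt; apply: leq_trans (ltnW ltij).
    by rewrite leqNgt count_part_gt // ltnn.
  by lia.
have rho_inj mu : is_part mu -> injective (rho_exp (n := n) mu).
  move=> pm i j; rewrite /rho_exp => E; apply/val_inj/eqP; case: ltngtP => //= lt.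
    by have := mono mu i j pm lt (ltn_ord j); rewrite E ltnn.
  by have := mono mu j i pm lt (ltn_ord i); rewrite E ltnn.
have main (s : 'S_n) : (forall i, rho_exp ka (s i) = rho_exp la i) -> s = 1%g.
  move=> Es; have incr (i j : 'I_n) : (i < j)%N -> (s i < s j)%N.
    move=> ltij; rewrite ltnNge; apply/negP; rewrite leq_eqVlt => /orP[/eqP/val_inj/perm_inj E|lt].
      by rewrite E ltnn in ltij.
    have := mono la i j pl ltij (ltn_ord j); have := mono ka (s j) (s i) pk lt (ltn_ord _).
    by have := Es i; have := Es j; rewrite /rho_exp; lia.
  (* An increasing self-map of ['I_n] lies above the identity; this is used for [s] and for its
     inverse. *)
  have ge (t : 'S_n) : (forall i j : 'I_n, (i < j)%N -> (t i < t j)%N) -> forall i : 'I_n,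
    (i <= t i)%N.
    move=> inc [i lti] /=; elim: i lti => // i IH lti.
    by apply: leq_ltn_trans (IH (ltnW lti)) (inc (Ordinal (ltnW lti)) (Ordinal lti) _).
  have incrV (i j : 'I_n) : (i < j)%N -> ((s^-1)%g i < (s^-1)%g j)%N.
    move=> ltij; rewrite ltnNge; apply/negP;
      rewrite leq_eqVlt => /orP[/eqP/val_inj/perm_inj E|/incr].
      by rewrite E ltnn in ltij.
    by rewrite !permKV => lt; have := ltn_trans lt ltij; rewrite ltnn.
  apply/permP => i; rewrite perm1; apply/val_inj/eqP; rewrite eqn_leq ge // andbT.
  by have := ge _ incrV (s i); rewrite permK.
rewrite (bigD1 1%g) //= big1 ?addr0 => [|s ns].
  rewrite odd_perm1 scale1r mcoeffX; congr (nat_of_bool _)%:R.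
  apply/eqP/forallP => [/mnmP E i|E].
    by have := E i; rewrite !mnmE perm1 /rho_exp => /addIn ->.
  by apply/mnmP => i; rewrite !mnmE perm1 /rho_exp (eqP (E i)).
rewrite mcoeffZ mcoeffX; case: eqP => [/mnmP E|_]; last by rewrite mulr0.
by case/eqP: ns; apply: main => i; have := E i; rewrite !mnmE.
Qed.

Lemma part_length_size la : (part_length la <= size la)%N.
Proof. exact: count_size. Qed.

Lemma head_le_sumn la : (head 0 la <= sumn la)%N.
Proof. by case: la => //= x s; apply: leq_addr. Qed.

Lemma vals_trunc N la : is_part la -> sumn la = N ->
  let ka := [tuple inord (nth 0%N la i) | i < N] : N.-tuple 'I_N.+1 in
  [/\ forall i, (i < N)%N -> nth 0%N (vals ka) i = nth 0%N la i,
      is_part (vals ka) & sumn (vals ka) = N].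
Proof.
move=> pl sl ka.
have E i : (i < N)%N -> nth 0%N (vals ka) i = nth 0%N la i.
  move=> lti; rewrite (nth_vals ka (Ordinal lti)) tnth_mktuple inordK // ltnS.
  by rewrite (leq_trans (nth_part_le_head i pl)) // -sl head_le_sumn.
split=> //.
  apply/(sortedP 0%N) => i; rewrite size_vals => lti; rewrite !E //; last exact: ltnW.
  rewrite /geq /= leqNgt -count_part_gt //; apply/negP => /ltnW.
  by rewrite count_part_gt // ltnn.
rewrite -(@nth_sumn_le _ N) ?size_vals // -[RHS]sl -(sum_nth_part pl (n := N)).
  by apply: eq_bigr => i _; apply: E.
by rewrite -[X in (_ <= X)%N]sl part_length_sumn.
Qed.

Lemma sum_delta (R : pzSemiRingType) (I : finType) (P : pred I) (i0 : I) (F f : I -> R) :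
  P i0 -> (forall i, P i -> F i = f i * (i == i0)%:R) -> \sum_(i | P i) F i = f i0.
Proof.
move=> P0 E; rewrite (bigD1 i0) //= E // eqxx mulr1 big1 ?addr0 // => i /andP[Pi /negbTE ni].
by rewrite E // ni mulr0.
Qed.

(** The chosen coefficients satisfy the defining expansion; multiplied by the Vandermonde product it
    becomes a sum of alternants, from which the monomial [la + rho] selects one. *)
Lemma lr_coefE N la mu nu : is_part la -> is_part mu -> is_part nu ->
  sumn la = N -> (sumn mu + sumn nu)%N = N ->
  lr_coef la mu nu = (schur_poly N mu * schur_poly N nu * vandermonde N)@_(rho_mon N la).
Proof.
move=> pl pm pn sl smn; rewrite -smn in sl *; move=> {N smn}.
rewrite /lr_coef sl eqxx; have := xchooseP (lr_expansion mu nu).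
set c := xchoose _; rewrite pm pn /= => /eqP ->.
set N := (sumn mu + sumn nu)%N in sl c *.
have [kaE pk sk] := vals_trunc pl sl; set ka := [tuple _ | i < N] in kaE pk sk *.
have term (x : N.-tuple 'I_N.+1) : is_part (vals x) ->
    (c x *: schur_poly N (vals x) * vandermonde N)@_(rho_mon N la) = c x * (x == ka)%:R.
  move=> px; rewrite -scalerAl schur_polyE; last first.
    by rewrite (leq_trans (part_length_size _)) // size_vals.
  rewrite mcoeffZ alternant_coef //; congr (_ * (nat_of_bool _)%:R).
  apply/forallP/eqP => [E|-> i]; last by rewrite kaE.
  apply: vals_inj; apply: (@eq_from_nth _ 0%N); rewrite !size_vals // => i lti.
  by rewrite kaE // (eqP (E (Ordinal lti))).
rewrite mulr_suml raddf_sum; apply/esym; apply: (@sum_delta _ _ _ ka _ (fun x => c x));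
  first by rewrite pk sk eqxx.
by move=> x /andP[px _]; exact: term.
Qed.

Lemma homog_coef_eq0 N la mu nu : is_part la -> is_part mu -> is_part nu ->
  (part_length la <= N)%N -> (part_length mu <= N)%N -> (part_length nu <= N)%N ->
  (sumn mu + sumn nu)%N != sumn la ->
  (schur_poly N mu * schur_poly N nu * vandermonde N)@_(rho_mon N la) = 0.
Proof.
move=> pl pm pn ll lm ln ne.
have hom : schur_poly N mu * schur_poly N nu * vandermonde N
    \is (sumn mu + sumn nu + \sum_(i < N) i)%N.-homog.
  by apply: dhomogM; [apply: dhomogM; apply: schur_poly_homog | apply: vandermonde_homog].
apply: (dhomog_nemf_coeff hom).
rewrite /= mdegE; under eq_bigr do rewrite mnmE.
by rewrite sum_rho_exp // eqn_add2r eq_sym.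
Qed.

Lemma mmap_genvars (F : fieldType) (X : seq F) :
  map (mmap intr (fun i : 'I_(size X) => X`_i)) (genvars int (size X)) = X.
Proof.
apply: (@eq_from_nth _ 0); rewrite size_map size_genvars // => i lti.
rewrite (nth_map 0) ?size_genvars //.
by have /= -> := nth_genvars int (Ordinal lti); rewrite mmapX mmap1U.
Qed.

Lemma schur_jacobi_trudi (F : fieldType) (X : seq F) N B la : is_part la ->
  (part_length la <= N)%N -> (sumn la < B)%N ->
  schur la X = jacobi_trudi N (hsym_gen B X) (add_rho N la).
Proof.
move=> pl leN ltB; rewrite /schur (schur_poly_jacobi_trudi _ pl leN ltB).
pose f : {rmorphism {mpoly int[size X]} -> F} := mmap intr (fun i : 'I_(size X) => X`_i).
by rewrite -[LHS]/(f _) jacobi_trudi_map map_hsym_gen mmap_genvars.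
Qed.

Lemma schur_conj_jacobi_trudi (F : fieldType) (Y : seq F) N la : is_part la ->
  (part_length la <= N)%N ->
  schur (conj_part la) Y = jacobi_trudi N (esym_gen [seq - y | y <- Y]) (add_rho N la).
Proof.
move=> pl leN; rewrite /schur (schur_poly_conj _ pl leN).
pose f : {rmorphism {mpoly int[size Y]} -> F} := mmap intr (fun i : 'I_(size Y) => Y`_i).
rewrite -[LHS]/(f _) jacobi_trudi_map map_esym_gen -[in RHS](mmap_genvars Y) -!map_comp.
by congr (jacobi_trudi _ (esym_gen _) _); apply: eq_map => i /=; apply: (rmorphN f).
Qed.

Lemma perm_factors (K : comPzRingType) (a b c d : K) : b * (a * c * d) = a * (c * b * d).
Proof. by ring. Qed.

(** In [D] auxiliary variables [z], the product of all [h(z_i) e(z_i)] is expanded twice: at once,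
    which gives the determinant of [h * e], and factor by factor, which gives products of two Schur
    polynomials. The coefficient at [la + rho], after multiplication by the Vandermonde product,
    compares the two. *)
Lemma LS_jacobi_trudi (F : fieldType) la (X Y : seq F) N B : is_part la ->
  (part_length la <= N)%N -> (sumn la < B)%N ->
  LS la X Y = jacobi_trudi N (hsym_gen B X * esym_gen [seq - y | y <- Y]) (add_rho N la).
Proof.
move=> pl leN ltB; set D := sumn la in ltB *.
(* Truncation beyond degree [D] leaves the determinants unchanged and bounds the partitions in the
   two separate expansions by [D], as in the definition of [LS]. *)
pose h := take_poly D.+1 (hsym_gen D.+1 X).
pose e := take_poly D.+1 (esym_gen [seq - y | y <- Y]).
have h0 : (hsym_gen B X * esym_gen [seq - y | y <- Y])`_0 = 1.
  by rewrite coef0M hsym_gen0 ?esym_gen0 ?mulr1 //; lia.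
have leD : (part_length la <= D)%N by exact: part_length_sumn.
have -> : jacobi_trudi N (hsym_gen B X * esym_gen [seq - y | y <- Y]) (add_rho N la) =
  jacobi_trudi D (h * e) (add_rho D la).
  rewrite (jacobi_trudi_stable h0 pl (leqnn _) leN) -(jacobi_trudi_stable h0 pl (leqnn _) leD).
  apply: jacobi_trudi_ext => r; rewrite sum_nth_part // => ler.
  rewrite !coefM; apply: eq_bigr => i _.
  have [lti ltri] : (i < D.+1)%N /\ (r - i < D.+1)%N by have := ltn_ord i; lia.
  rewrite !coef_take_poly lti ltri.
  by rewrite (@hsym_gen_ext _ D.+1 B) //; have := ltn_ord i; lia.
pose cf (p : {mpoly F[D]}) : F := p@_(rho_mon D la).
have Pmu (mu : D.-tuple 'I_D.+1) : (part_length (vals mu) <= D)%N.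
  by rewrite (leq_trans (part_length_size _)) // size_vals.
have szh : (size h <= D.+1)%N by exact: size_take_poly.
have sze : (size e <= D.+1)%N by exact: size_take_poly.
have intmpM (p q : {mpoly int[D]}) : intmp F (p * q) =
  intmp F p * intmp F q :> {mpoly F[D]} by exact: rmorphM.
have expand (g : {poly F}) : (size g <= D.+1)%N ->
   (\prod_(z <- genvars F D) (map_poly (@mpolyC D F) g).[z]) * intmp F (vandermonde D) =
   \sum_(mu : D.-tuple 'I_D.+1 | is_part (vals mu))
     (jacobi_trudi D g (add_rho D (vals mu)))%:MP * intmp F (schur_poly D (vals mu)) * intmp F
       (vandermonde D).
  move=> szg; rewrite (schur_expansion _ szg); apply: eq_bigr => mu pm.
  by rewrite -(schur_polyE (Pmu mu)) intmpM mulrA.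
have Ecoef : cf ((\prod_(z <- genvars F D) (map_poly (@mpolyC D F) (h * e)).[z]) *
     intmp F (vandermonde D)) = jacobi_trudi D (h * e) (add_rho D la).
  (* The product [h * e] may have degree [2 D], so larger tuples are needed here. *)
  rewrite (@schur_expansion _ _ (D + D)); last first.
    rewrite (leq_trans (size_polyMleq _ _)) //; move: (size h) (size e) szh sze => a b; lia.
  rewrite /cf raddf_sum /=.
  pose ka := inord_tuple D (D + D) (mkseq (nth 0%N la) D).
  have nth_la i : (nth 0 la i <= D)%N.
    by rewrite (leq_trans (nth_part_le_head i pl)) // head_le_sumn.
  have kaE : vals ka = mkseq (nth 0%N la) D.
    apply: vals_inord_tuple; first by rewrite size_mkseq.
    by apply/allP => _ /mapP[i _ ->] /=; rewrite (leq_trans (nth_la i)) ?leq_addr.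
  have pk : is_part (vals ka).
    apply/(sortedP 0%N) => i; rewrite kaE size_mkseq => lti.
    rewrite !nth_mkseq //; last exact: ltnW.
    rewrite /geq /= leqNgt -count_part_gt //; apply/negP => /ltnW.
    by rewrite count_part_gt // ltnn.
  have term (mu : D.-tuple 'I_(D + D).+1) : is_part (vals mu) ->
      ((jacobi_trudi D (h * e) (add_rho D (vals mu)))%:MP * intmp F (alternant (rho_exp (vals
        mu))))@_(rho_mon D la)
      = jacobi_trudi D (h * e) (add_rho D (vals mu)) * (mu == ka)%:R.
    move=> pm; rewrite mcoeffCM /intmp mcoeff_map_mpoly alternant_coef //; congr (_ * _).
    have -> : [forall i : 'I_D, nth 0%N (vals mu) i == nth 0%N la i] = (mu == ka).
      apply/forallP/eqP => [E|-> i]; last by rewrite kaE nth_mkseq.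
      apply: vals_inj; apply: (@eq_from_nth _ 0%N); rewrite !size_vals // => i lti.
      by rewrite kaE nth_mkseq // (eqP (E (Ordinal lti))).
    by case: (mu == ka).
  transitivity (jacobi_trudi D (h * e) (add_rho D (vals ka))).
    exact: (@sum_delta _ _ _ ka _ (fun mu => jacobi_trudi D (h * e) (add_rho D (vals mu)))).
  rewrite kaE; congr jacobi_trudi; apply: (@eq_from_nth _ 0%N); rewrite !size_mkseq // => i lti.
  by rewrite !nth_add_rho // nth_mkseq.
rewrite -Ecoef.
transitivity (\sum_(mu : D.-tuple 'I_D.+1 | is_part (vals mu))
  \sum_(nu : D.-tuple 'I_D.+1 | is_part (vals nu))
    jacobi_trudi D h (add_rho D (vals mu)) * jacobi_trudi D e (add_rho D (vals nu)) *
    ((schur_poly D (vals mu) * schur_poly D (vals nu) * vandermonde D)@_(rho_mon D la))%:~R).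
  rewrite /LS -/D; apply: eq_bigr => mu pm; apply: eq_bigr => nu pn.
  case: (eqVneq (sumn (vals mu) + sumn (vals nu))%N D) => [sD|nD]; last first.
    by rewrite homog_coef_eq0 // mulr0 /lr_coef eq_sym (negbTE nD) !mul0r.
  rewrite -(@lr_coefE D) // -mulrA mulrC; congr (_ * _ * _).
    rewrite (@schur_jacobi_trudi _ _ D D.+1) //; last by lia.
    apply: jacobi_trudi_ext => r; rewrite sum_nth_part // => ler.
    have ltr : (r < D.+1)%N by lia.
    by rewrite coef_take_poly ltr.
  rewrite (@schur_conj_jacobi_trudi _ _ D) //; apply: jacobi_trudi_ext => r;
    rewrite sum_nth_part // => ler.
  have ltr : (r < D.+1)%N by lia.
  by rewrite coef_take_poly ltr.
rewrite (eq_bigr (fun z => (map_poly (@mpolyC D F) h).[z] * (map_poly (@mpolyC D F) e).[z]));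
  last first.
  by move=> z _; rewrite rmorphM hornerM.
rewrite big_split -mulrA (expand e sze) mulr_sumr exchange_big /cf raddf_sum /=.
apply: eq_bigr => nu pn.
set Ph := \prod_(z <- _) _; set ce := jacobi_trudi D e _.
have -> : Ph * (ce%:MP * intmp F (schur_poly D (vals nu)) * intmp F (vandermonde D)) =
    ce%:MP * (intmp F (schur_poly D (vals nu)) * (Ph * intmp F (vandermonde D))).
  by rewrite mulrCA -!mulrA; congr (_ * _); rewrite mulrCA.
rewrite (expand h szh) mulr_sumr mcoeffCM raddf_sum mulr_sumr /=.
apply: eq_bigr => mu pm.
set cm := jacobi_trudi D h _.
have -> : intmp F (schur_poly D (vals nu)) *
    (cm%:MP * intmp F (schur_poly D (vals mu)) * intmp F (vandermonde D)) =
    cm%:MP * intmp F (schur_poly D (vals mu) * schur_poly D (vals nu) * vandermonde D).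
  rewrite (intmpM (schur_poly D (vals mu) * schur_poly D (vals nu))).
  by rewrite (intmpM (schur_poly D (vals mu))); apply: perm_factors.
by rewrite mcoeffCM /intmp mcoeff_map_mpoly mulrA [ce * cm]mulrC.
Qed.

(** * Reindexing by overlaps and conclusion *)

Lemma is_part_nth la i j : is_part la -> (i <= j)%N -> (nth 0 la j <= nth 0 la i)%N.
Proof.
move=> pl le; rewrite leqNgt -count_part_gt // -leqNgt (leq_trans _ le) //.
by rewrite leqNgt count_part_gt // ltnn.
Qed.

(** Admissibility of [k] bounds the parts beyond the first [n - k] from above. If [m - k > 0] and
    one of the first [n - k] parts were less than [m - k], then [k + 1] would be admissible too. *)
Lemma index_bounds m n la k : is_part la -> is_index m n la k ->
  let mk := `|m%:Z - k|%N in
  let nk := `|n%:Z - k|%N in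
  [/\ (mk + n = m + nk)%N, nk%:Z = n%:Z - k, 
      forall i, (i < nk)%N -> (mk <= nth 0 la i)%N
    & forall i, (nk <= i)%N -> (nth 0 la i <= mk)%N].
Proof.
move=> pl [[lek nin] maxk] mk nk.
have [lekm lekn] : k <= m%:Z /\ k <= n%:Z by lia.
have mkE : mk%:Z = m%:Z - k by rewrite /mk; lia.
have nkE : nk%:Z = n%:Z - k by rewrite /nk; lia.
split=> //; first by lia.
  move=> i lti; apply: leq_trans (is_part_nth pl (_ : i <= nk.-1)%N); last by lia.
  case: (posnP mk) => [->//|mk0].
  rewrite leqNgt; apply/negP => lt.
  have := maxk (k + 1); rewrite /is_true => h.
  suff : k + 1 <= k by lia.
  apply: h; split; first by lia.
  have -> : m%:Z + 1 - (k + 1) = mk by lia.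
  have -> : n%:Z + 1 - (k + 1) = nk by lia.
  rewrite /= !negb_or -!lt0n mk0 /=; apply/andP; split; first by lia.
  by rewrite subn_gt0.
move=> i le; apply: leq_trans (is_part_nth pl le) _.
move: nin; have -> : m%:Z + 1 - k = mk.+1 by lia.
have -> : n%:Z + 1 - k = nk.+1 by lia.
by rewrite /= -ltnNge ltnS.
Qed.

Lemma at_pos_sorted (L : seq nat) q : sorted gtn L -> sorted ltn q ->
  all (ltn^~ (size L)) q -> sorted gtn (at_pos 0%N L q).
Proof.
move=> sL sq aq; apply/(sortedP 0%N) => i; rewrite size_map => lti.
have gT : transitive gtn by move=> y x z /= h1 h2; apply: ltn_trans h2 h1.
rewrite !(nth_map 0%N) // 1?ltnW //.
apply: (sorted_ltn_nth gT 0%N sL); rewrite ?inE; try by apply: (allP aq); rewrite mem_nth // ltnW.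
by have /(sortedP 0%N)/(_ i lti) := sq.
Qed.

Lemma at_pos_cat (T : Type) (x0 : T) s p q : at_pos x0 s (p ++ q) = at_pos x0 s p ++ at_pos x0 s q.
Proof. exact: map_cat. Qed.

Lemma at_pos_iota (T : Type) (x0 : T) s n : size s = n -> at_pos x0 s (iota 0 n) = s.
Proof. by move=> <-; apply: mkseq_nth. Qed.

(** A pair with overlap [ka] is a splitting of the strictly decreasing sequence [ka + rho] into two
    subsequences, hence a subset of its positions; [D] is large enough for every such pair to be
    represented. *)
Lemma sum_overlap (R : nmodType) a b K D ka (H : seq nat -> seq nat -> int -> R) :
  K = (a + b)%N -> is_part ka -> size ka = K -> (head 0 ka + K <= D)%N ->
  \sum_(mu : a.-tuple 'I_D.+1 | is_part (vals mu))
  \sum_(nu : b.-tuple 'I_D.+1 | is_part (vals nu) && (overlap a b (vals mu) (vals nu) == Some ka))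
     H (add_rho a (vals mu)) (add_rho b (vals nu)) (overlap_sign a b (vals mu) (vals nu)) =
  \sum_(M : {set 'I_K} | #|M| == a)
     H (at_pos 0%N (add_rho K ka) (pos M)) (at_pos 0%N (add_rho K ka) (pos (~: M)))
       ((-1) ^+ inversions (pos M) (pos (~: M))).
Proof.
move=> EK pk sk leD; subst K; set L := add_rho (a + b) ka.
have sL : size L = (a + b)%N by rewrite size_mkseq.
have soL : sorted gtn L by exact: add_rho_gtn.
have gI : irreflexive gtn by move=> x; exact: ltnn.
have gT : transitive gtn by move=> y x z /= h1 h2; apply: ltn_trans h2 h1.
have uL : uniq L by exact: (sorted_uniq gT gI soL).
have L_le x : x \in L -> (x <= D)%N.
  move=> /mapP[i _ ->]; apply: leq_trans leD; apply: leq_add (leq_subr _ _).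
  exact: nth_part_le_head.
have soM (M : {set 'I_(a + b)}) : sorted gtn (at_pos 0%N L (pos M)).
  by apply: at_pos_sorted; rewrite ?pos_sorted // sL all_pos.
have memM (M : {set 'I_(a + b)}) x : reflect (exists2 i,
  i \in M & x = nth 0%N L (val i)) (x \in at_pos 0%N L (pos M)).
  apply: (iffP mapP) => [[_ /mapP[i ii ->] ->]|[i ii ->]].
    by exists i => //; rewrite -mem_enum.
  by exists (val i); rewrite ?mem_pos.
have permM (M : {set 'I_(a + b)}) : perm_eq L (at_pos 0%N L (pos M) ++ at_pos 0%N L (pos (~: M))).
  rewrite -{1}(at_pos_iota 0%N sL) -at_pos_cat; apply: perm_map; exact: perm_pos.
pose T c := c.-tuple 'I_D.+1.
pose h (M : {set 'I_(a + b)}) : T a * T b :=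
  (inord_tuple a D (sub_rho a (at_pos 0%N L (pos M))),
   inord_tuple b D (sub_rho b (at_pos 0%N L (pos (~: M))))).
pose h' (mn : T a * T b) : {set 'I_(a + b)} :=
  [set i | nth 0%N L (val i) \in add_rho a (vals mn.1)].
have tupE c (M : {set 'I_(a + b)}) : #|M| = c ->
    let t := inord_tuple c D (sub_rho c (at_pos 0%N L (pos M))) in
    is_part (vals t) /\ add_rho c (vals t) = at_pos 0%N L (pos M).
  move=> cM t; have [|root_poly Ew] := @sub_rhoP c _ (soM M); first by rewrite size_map size_pos.
  suff -> : vals t = sub_rho c (at_pos 0%N L (pos M)) by [].
  apply: vals_inord_tuple; rewrite ?size_mkseq //.
  apply/allP => x /mapP[i]; rewrite mem_iota add0n => lti -> /=.
  apply: leq_trans (leq_subr _ _) _; apply: L_le.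
  by rewrite (perm_mem (permM M)) mem_cat mem_nth // size_map size_pos cM.
have cardC (M : {set 'I_(a + b)}) : #|M| = a -> #|~: M| = b.
  by move=> cM; have := cardsC M; rewrite card_ord cM => /addnI.
have key (mu : T a) (nu : T b) : is_part (vals mu) -> is_part (vals nu) ->
    overlap a b (vals mu) (vals nu) == Some ka ->
    at_pos 0%N L (pos (h' (mu, nu))) = add_rho a (vals mu) /\
    at_pos 0%N L (pos (~: h' (mu, nu))) = add_rho b (vals nu).
  move=> pm pn /eqP/overlapP[_ _ pe].
  have uc : uniq (add_rho a (vals mu) ++ add_rho b (vals nu)) by rewrite -(perm_uniq pe).
  have inL x : x \in L -> exists i : 'I_(a + b), x = nth 0%N L (val i).
    move=> xL; have lt : (index x L < a + b)%N by rewrite -sL index_mem.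
    by exists (Ordinal lt); rewrite /= nth_index.
  split; apply: gtn_sorted_eq => //; try by apply: add_rho_gtn; rewrite ?size_vals.
    move=> x; apply/memM/idP => [[i]|xin]; first by rewrite inE => ii ->.
    have /inL[i Ei] : x \in L by rewrite (perm_mem pe) mem_cat xin.
    by exists i; rewrite // inE -Ei.
  move=> x; apply/memM/idP => [[i]|xin].
    rewrite !inE => ni ->; have : nth 0%N L (val i) \in L by rewrite mem_nth // sL; apply: ltn_ord.
    by rewrite (perm_mem pe) mem_cat (negbTE ni).
  have /inL[i Ei] : x \in L by rewrite (perm_mem pe) mem_cat xin orbT.
  exists i; rewrite // !inE -Ei; move: uc; rewrite cat_uniq => /and3P[_ /hasPn h0 _].
  exact: h0.
rewrite pair_big_dep /= (reindex_onto h h') /=; last first.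
  move=> [mu nu] /= /andP[pm /andP[pn ov]]; have [E1 E2] := key mu nu pm pn ov.
  rewrite /h E1 E2 !sub_add_rho ?size_vals //.
  congr pair; apply: vals_inj; rewrite vals_inord_tuple ?size_vals //;
    by apply/allP => _ /mapP[i _ ->]; rewrite /= -ltnS.
have predE M : [&& is_part (vals (h M).1), is_part (vals (h M).2)
      & overlap a b (vals (h M).1) (vals (h M).2) == Some ka] && (h' (h M) == M) = (#|M| == a).
  apply/idP/eqP => [/andP[/and3P[pm pn ov] /eqP EM]|cM].
    have [E1 _] := key _ _ pm pn ov.
    by have := congr1 size E1; rewrite -surjective_pairing EM size_map size_pos size_mkseq.
  have [pm Em] := tupE _ _ cM; have [pn En] := tupE _ _ (cardC _ cM).
  rewrite pm pn /=; apply/andP; split.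
    by apply/eqP/overlapP; split; rewrite // Em En; exact: permM.
  apply/eqP/setP => i; rewrite inE Em; apply/memM/idP => [[j jM /eqP]|iM]; last by exists i.
  by rewrite nth_uniq ?sL; try exact: ltn_ord; move=> // /eqP/val_inj ->.
apply: eq_big => [M|M]; first by rewrite -predE andbA.
rewrite -!andbA => /and4P[pm0 pn0 /eqP ov EM].
have /eqP cM : #|M| == a by rewrite -predE pm0 pn0 ov eqxx EM.
have [pm Em] := tupE _ _ cM; have [pn En] := tupE _ _ (cardC _ cM).
rewrite Em En; congr (H _ _ _).
rewrite /overlap_sign ov Em En.
set w := at_pos 0%N L (pos M) ++ at_pos 0%N L (pos (~: M)).
have sw : size w = (a + b)%N by rewrite size_cat !size_map -!cardE cM cardC.
have uw : uniq w by rewrite -(perm_uniq (permM M)).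
case: pickP => [s /eqP Es|nos].
  apply: (sign_vdm sw sL uw).
    by move=> i; rewrite -[L in LHS]Es (nth_map i) ?size_enum_ord // nth_ord_enum.
  (* Both signs relate the integer Vandermonde products of [L] and [w], which are nonzero, so they
     agree. *)
  have := @vdm_split _ (pos M) (pos (~: M)) (iota 0 (a + b)) (fun i => Posz (nth 0%N L i))
    (pos_sorted _) (pos_sorted _) (iota_ltn_sorted _ _) (perm_pos M).
  have mc q : [seq Posz (nth 0%N L i) | i <- q] = map Posz (at_pos 0%N L q).
    by rewrite -map_comp.
  by rewrite !mc at_pos_iota // at_pos_cat.
have [|s Es] := @perm_eq_nth w L (a + b) sw; first by rewrite perm_sym permM.
have /eqP[] := nos s; apply: (@eq_from_nth _ 0%N); rewrite size_map size_enum_ord ?sL // => i lti.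
by have /= -> := Es (Ordinal lti);
  rewrite (nth_map (Ordinal lti)) ?size_enum_ord // (nth_ord_enum _ (Ordinal lti)).
Qed.

(** * Bookkeeping for the final comparison *)

Lemma delta2_opp (R : comNzRingType) (X Y : seq R) :
  delta2 [seq - x | x <- X] [seq - y | y <- Y] = delta2 Y X.
Proof.
rewrite /delta2 big_map exchange_big big_map /=; apply: eq_bigr => y _.
by apply: eq_bigr => x _; rewrite opprK addrC.
Qed.

Lemma delta2_sym (R : comNzRingType) (X Y : seq R) :
  delta2 X Y = (-1) ^+ (size X * size Y) * delta2 Y X.
Proof.
have P x : \prod_(y <- Y) (x - y) = (-1) ^+ size Y * \prod_(y <- Y) (y - x).
  elim: Y => [|y Y IH]; first by rewrite !big_nil mul1r.
  by rewrite !big_cons IH /= exprS; ring.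
elim: X => [|x X IH]; first by rewrite /delta2 big_nil mul1r big1 // => y _; rewrite big_nil.
rewrite delta2_consr /= mulSn exprD -[LHS]/(\prod_(x0 <- x :: X) _) big_cons.
by rewrite -/(delta2 X Y) IH P; ring.
Qed.

Lemma subseq_at_pos (R : comNzRingType) m (Y : m.-tuple R) (A : {set 'I_m}) :
  subseq_at Y A = at_pos 0 Y (pos A).
Proof.
rewrite /subseq_at /at_pos /pos -map_comp; apply: eq_map => i /=.
exact: tnth_nth.
Qed.

Lemma at_pos_opp (R : comNzRingType) (Y : seq R) q :
  at_pos 0 [seq - y | y <- Y] q = [seq - y | y <- at_pos 0 Y q].
Proof.
rewrite /at_pos -map_comp; apply: eq_map => i /=.
case: (ltnP i (size Y)) => lt; first by rewrite (nth_map 0).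
by rewrite !nth_default ?size_map // oppr0.
Qed.

Lemma sumn_le s b : all (leq^~ b) s -> (sumn s <= size s * b)%N.
Proof. by elim: s => //= x s IH /andP[le al]; rewrite mulSn leq_add ?IH. Qed.

Lemma complement_unique (F : fieldType) m (Y : m.-tuple F) p (A B : {set 'I_m}) :
  uniq Y -> #|A| = p ->
  ((#|B| == m - p)%N && perm_eq (subseq_at Y A ++ subseq_at Y B) Y) = (B == ~: A).
Proof.
move=> uY cA; have inj : injective (tnth Y) by apply/tuple_uniqP.
apply/andP/eqP => [[/eqP cB pe]|->].
  have ue : uniq (subseq_at Y A ++ subseq_at Y B) by rewrite (perm_uniq pe).
  apply/eqP; rewrite eqEcard; apply/andP; split; last first.
    by have := cardsC A; rewrite card_ord cB cA; lia.
  apply/subsetP => i iB; rewrite inE; apply/negP => iA.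
  move: ue; rewrite cat_uniq => /and3P[_ /hasPn/(_ (tnth Y i))] h _.
  by move: h; rewrite /= !map_f ?mem_enum // => /(_ isT).
split; first by have := cardsC A; rewrite card_ord cA => E; apply/eqP; lia.
rewrite !subseq_at_pos -at_pos_cat perm_sym -[X in perm_eq X](at_pos_iota 0 (size_tuple Y)).
apply: perm_map; exact: perm_pos.
Qed.

Lemma delta_uniq (F : fieldType) (Y : seq F) : delta Y != 0 -> uniq Y.
Proof.
move=> nz; rewrite -vdm_uniq (vdm_nth erefl).
apply/prodf_neq0 => i _; apply/prodf_neq0 => j lt.
move/prodf_neq0: nz => /(_ i isT)/prodf_neq0/(_ j lt).
by rewrite -opprB oppr_eq0.
Qed.

Lemma delta2_neq0 (F : fieldType) (X Y : seq F) : uniq (X ++ Y) -> delta2 X Y != 0.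
Proof.
by rewrite -vdm_uniq vdm_cat delta2_sym !mulf_eq0 signr_eq0 !negb_or => /andP[_].
Qed.

Lemma add_rho_shift nk r la q : all (ltn^~ nk) q ->
  at_pos 0%N (add_rho (nk + r) la) q =
  map (addn r) (at_pos 0%N (add_rho nk (mkseq (nth 0%N la) nk)) q).
Proof.
move=> /allP aq; rewrite /at_pos -map_comp; apply/eq_in_map => i /aq /= lti.
by rewrite !nth_add_rho ?nth_mkseq // ?ltn_addr //; lia.
Qed.

(** The last entry of [rho] is 0, so the smallest part itself occurs in [mu + rho]. *)
Lemma part_ge_add_rho a mk mu : is_part mu -> size mu = a -> all (leq mk) (add_rho a mu) ->
  all (leq mk) mu.
Proof.
move=> pm sz al; apply/(all_nthP 0%N) => i; rewrite sz => lti.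
have lta : (a.-1 < a)%N by lia.
apply: leq_trans (is_part_nth pm (_ : i <= a.-1)%N); last by lia.
have := all_nthP 0%N al a.-1; rewrite size_mkseq => /(_ lta).
by rewrite nth_add_rho // prednK ?subnn ?addn0 //; lia.
Qed.

Lemma add_rho_sub a mk mu : size mu = a -> all (leq mk) mu ->
  map (subn^~ mk) (add_rho a mu) = add_rho a [seq (x - mk)%N | x <- mu].
Proof.
move=> sz al; apply: (@eq_from_nth _ 0%N); rewrite size_map !size_mkseq // => i lti.
rewrite (nth_map 0%N) ?size_mkseq // !nth_add_rho // (nth_map 0%N) ?sz //.
by have := all_nthP 0%N al i; rewrite sz => /(_ lti) /=; lia.
Qed.

Lemma is_part_sub mk mu : is_part mu -> is_part [seq (x - mk)%N | x <- mu].
Proof.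
move=> pm; apply/(sortedP 0%N) => i; rewrite size_map => lti.
rewrite !(nth_map 0%N) //; last exact: ltnW.
by have := is_part_nth pm (leqnSn i); rewrite /geq /=; lia.
Qed.

(** The extraction rows beyond the first [nk] all stay in the second block; this is how [nu] is
    continued by the remaining parts of [la]. *)
Lemma add_rho_cat b r nu la nk : size nu = b ->
  map (addn r) (add_rho b nu) ++ at_pos 0%N (add_rho (nk + r) la) (map (addn nk) (iota 0 r)) =
  add_rho (b + r) (nu ++ drop nk la).
Proof.
move=> sz; apply: (@eq_from_nth _ 0%N).
  by rewrite size_cat !size_map !size_iota.
move=> i; rewrite size_cat !size_map !size_iota => lti.
rewrite [RHS]nth_add_rho // !nth_cat size_map size_mkseq sz nth_drop.
case: (ltnP i b) => le; first by rewrite (nth_map 0%N) ?size_mkseq // nth_add_rho //; lia.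
rewrite (nth_map 0%N) ?size_map ?size_iota; last by lia.
rewrite (nth_map 0%N) ?size_iota; last by lia.
rewrite nth_iota ?add0n; last by lia.
by rewrite nth_add_rho; lia.
Qed.

Lemma is_part_cat_drop b nu la nk : is_part nu -> size nu = b -> is_part la ->
  all (leq (nth 0%N la nk)) nu -> is_part (nu ++ drop nk la).
Proof.
move=> pn sz pl al; apply/(sortedP 0%N) => i lti.
rewrite /geq /= !nth_cat; case: (ltnP i.+1 (size nu)) => lt.
  by rewrite (ltnW lt) is_part_nth.
case: (ltnP i (size nu)) => lt'.
  rewrite nth_drop (leq_trans _ (all_nthP 0%N al i lt')) // is_part_nth //; lia.
by rewrite !nth_drop is_part_nth //; lia.
Qed.

Lemma sum_by_card (R : nmodType) m q (f : {set 'I_m} -> R) :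
  (forall A : {set 'I_m}, (q < #|A|)%N -> f A = 0) ->
  \sum_(A : {set 'I_m}) f A = \sum_(p < q.+1) \sum_(A : {set 'I_m} | #|A| == p) f A.
Proof.
move=> f0; rewrite (exchange_big_dep xpredT) //=; apply: eq_bigr => A _.
case: (ltnP #|A| q.+1) => [lt|le].
  by rewrite (big_pred1 (Ordinal lt)) // => p; rewrite eq_sym.
by rewrite big1 ?f0 // => p /eqP E; have := ltn_ord p; rewrite -E ltnNge le.
Qed.

Lemma sum_first_block (R : nmodType) nk r a (G : seq nat -> seq nat -> R) :
  (forall q q', has (leq nk) q -> G q q' = 0) ->
  \sum_(M : {set 'I_(nk + r)} | #|M| == a) G (pos M) (pos (~: M)) =
  \sum_(M : {set 'I_nk} | #|M| == a)
     G (pos M) (pos (~: M) ++ map (addn nk) (iota 0 r)).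
Proof.
move=> G0; rewrite (sum_join nk r a G) [RHS]big_mkcond; apply: eq_bigr => M _.
have z (M' : {set 'I_r}) q : M' != set0 -> G (pos M ++ map (addn nk) (pos M')) q = 0.
  move=> /set0Pn[i iM]; apply: G0; rewrite has_cat; apply/orP; right.
  by apply/hasP; exists (nk + i)%N; rewrite ?leq_addr // map_f // mem_pos.
case: eqP => cM.
  rewrite (bigD1 set0) ?cards0 ?addn0 ?cM ?eqxx //= big1 ?addr0.
    by rewrite setC0 {2}/pos !enum_set0 cats0 /pos enum_setT -enumT val_enum_ord.
  by move=> M' /andP[_ nM]; apply: z.
rewrite big1 // => M' /eqP E; apply: z; apply/eqP => M0.
by move: E; rewrite M0 cards0 addn0.
Qed.

Theorem theorem3p6 (F : fieldType) (la : seq nat) (m n l : nat) (k : int)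
    (S : l.-tuple F) (T : (n - l).-tuple F) (Y : m.-tuple F) :
  is_part la ->
  is_index m n la k ->
  l%:Z <= Num.min (n%:Z - k) n%:Z ->
  delta Y != 0 ->
  delta2 S T != 0 ->
  let mk := `|m%:Z - k|%N in
  let nk := `|n%:Z - k|%N in
  let bound := (head 0%N la + nk)%N in
  LS la [seq - x | x <- S ++ T] Y =
  \sum_(p < (minn l m).+1)
  \sum_(A : {set 'I_m} | #|A| == p)
  \sum_(B : {set 'I_m} |
      (#|B| == m - p)%N && perm_eq (subseq_at Y A ++ subseq_at Y B) Y)
  \sum_(mu : (l - p).-tuple 'I_bound.+1 | is_part (vals mu))
  \sum_(nu : (nk - l + p).-tuple 'I_bound.+1 |
      is_part (vals nu) &&
      (overlap (l - p) (nk - l + p) (vals mu) (vals nu)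
         == Some (mkseq (nth 0%N la) nk)))
    let U := subseq_at Y A in
    let V := subseq_at Y B in
    (delta2 V S * delta2 T U) / (delta2 V U * delta2 T S)
    * (overlap_sign (l - p) (nk - l + p) (vals mu) (vals nu))%:~R
    * LS [seq (x - mk)%N | x <- vals mu] [seq - x | x <- S] U
    * LS (vals nu ++ drop nk la) [seq - x | x <- T] V.
Proof.
move=> pl idx lel dY dST mk nk bound.
have [mkE nkE hi lo] := index_bounds pl idx; rewrite -/mk -/nk in mkE nkE hi lo.
have uY := delta_uniq dY.
have [leln lelnk] : (l <= n)%N /\ (l <= nk)%N by lia.
set S' := [seq - x | x <- S]; set T' := [seq - x | x <- T].
pose Y' := [seq - y | y <- Y].
rewrite map_cat -/S' -/T'.
(* The padding [r] makes room for all of [la] and ensures [n <= m + N]. [B] exceeds every entry of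
   [d] and the size of every partition that occurs below. *)
pose r := (size la + n).+1; pose N := (nk + r)%N; pose t := (r + mk)%N.
pose B := (N * bound + bound + sumn la + N).+1.
pose ka := mkseq (nth 0%N la) nk.
pose d := add_rho N la; pose L := add_rho nk ka.
have sS' : size S' = l by rewrite size_map size_tuple.
have sT' : size T' = (n - l)%N by rewrite size_map size_tuple.
have sY' : size Y' = m by rewrite size_map size_tuple.
have tE : (m + N - (l + size T') = t)%N by rewrite sT' /t /N; lia.
have plen : (part_length la <= N)%N.
  by rewrite (leq_trans (part_length_size _)) // /N /r; lia.
have dB i : (i < N)%N -> (nth 0%N d i < B)%N.
  move=> lti; rewrite nth_add_rho // /B; have := nth_part_le_head i pl.
  by rewrite /bound; lia.
have := @jacobi_trudi_split _ S' T' Y' m l N B (hsym_gen B (S' ++ T')) (hsym_gen B S') (hsym_gen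
  B T') d sY' sS'.
rewrite /= tE => split0.
have {split0} := split0 _ _ _ dB.
have le1 : (l + size T' <= m + N)%N by rewrite sT' /N /r; lia.
have g1 (g : {poly F}) e : (e < B)%N -> (hsym_gen B (S' ++ T') * esym_gen T' * g)`_e =
  (hsym_gen B S' * g)`_e.
  exact: hsym_gen_catM.
have g2 (g : {poly F}) e : (e < B)%N -> (hsym_gen B (S' ++ T') * esym_gen S' * g)`_e =
  (hsym_gen B T' * g)`_e.
  by rewrite (hsym_gen_perm _ (permEl (perm_catC S' T'))); apply: hsym_gen_catM.
move=> /(_ le1 g1 g2); rewrite -/Y' -(@LS_jacobi_trudi _ la) //; last by rewrite /B; lia.
pose term (A : {set 'I_m}) q q' : F :=
  let U := at_pos 0 Y' (pos A) in let V := at_pos 0 Y' (pos (~: A)) in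
  (-1) ^+ (inversions (pos A) (pos (~: A)) + inversions q q' + size q * size (pos (~: A))) *
    (delta2 U T' * vdm U *
      (if all (leq t) (at_pos 0%N d q)
       then jacobi_trudi (size q) (hsym_gen B S' * esym_gen U) (map (subn^~ t) (at_pos 0%N d q))
         else 0)) *
    (delta2 V S' * vdm V * jacobi_trudi (size q') (hsym_gen B T' * esym_gen V) (at_pos 0%N d q')).
rewrite -[RHS in _ = RHS -> _]/(\sum_(A : {set 'I_m}) \sum_(M : {set 'I_N} | (#|A| + #|M|)%N ==
  l) term A (pos M) (pos (~: M))).
set c := vdm Y' * delta2 S' T' => split0.
have uY' : uniq Y' by rewrite map_inj_uniq //; exact: oppr_inj.
have c0 : c != 0.
  by rewrite mulf_neq0 ?vdm_uniq // delta2_opp delta2_sym mulf_neq0 ?signr_eq0.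
apply: (mulfI c0); rewrite [LHS]mulrAC split0 => {split0}.
rewrite (@sum_by_card _ _ (minn l m)); last first.
  move=> A ltA; rewrite big1 // => M /eqP E.
  by have := max_card A; rewrite card_ord; lia.
rewrite mulr_sumr; apply: eq_bigr => p _; rewrite mulr_sumr; apply: eq_bigr => A /eqP cA.
have lep : (p <= l)%N /\ (p <= m)%N by have := ltn_ord p; lia.
rewrite [X in _ = _ * X](big_pred1 (~: A)); last by move=> A'; apply: complement_unique.
set a := (l - p)%N; set b := (nk - l + p)%N.
have Eab : nk = (a + b)%N by lia.
set U := subseq_at Y A; set V := subseq_at Y (~: A).
have UE : at_pos 0 Y' (pos A) = [seq - y | y <- U] by rewrite at_pos_opp /U subseq_at_pos.
have VE : at_pos 0 Y' (pos (~: A)) = [seq - y | y <- V] by rewrite at_pos_opp /V subseq_at_pos.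
pose J1 w := jacobi_trudi a (hsym_gen B S' * esym_gen [seq - y | y <- U]) (map (subn^~ t) (map
  (addn r) w)).
pose tail := at_pos 0%N d (map (addn nk) (iota 0 r)).
pose J2 w := jacobi_trudi (b + r) (hsym_gen B T' * esym_gen [seq - y | y <- V]) (map (addn r) w
  ++ tail).
pose pref := (delta2 V S * delta2 T U) / (delta2 V U * delta2 T S).
pose H w1 w2 (e : int) := pref * e%:~R * J1 w1 * J2 w2.
transitivity (c * \sum_(M : {set 'I_nk} | #|M| == a)
    H (at_pos 0%N L (pos M)) (at_pos 0%N L (pos (~: M)))
      ((-1) ^+ inversions (pos M) (pos (~: M)))).
  rewrite (eq_bigl (fun M : {set 'I_N} => #|M| == a)); last first.
    by move=> M; rewrite cA /a; lia.
  rewrite (@sum_first_block _ nk r a (term A)); last first.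
    move=> q q' /hasP[i iq lei]; rewrite /term.
    have /negbTE -> : ~~ all (leq t) (at_pos 0%N d q).
      apply/allPn; exists (nth 0%N d i); first exact: map_f.
      rewrite -ltnNge; case: (ltnP i N) => ltN; last first.
        by rewrite nth_default ?size_mkseq // /t /r; lia.
      by rewrite nth_add_rho // /t; have := lo i lei; rewrite /N; lia.
    by rewrite mulr0 mulr0 mul0r.
  rewrite mulr_sumr; apply: eq_bigr => M /eqP cM.
  have dM : at_pos 0%N d (pos M) = map (addn r) (at_pos 0%N L (pos M)).
    by apply: add_rho_shift; exact: all_pos.
  have dMc : at_pos 0%N d (pos (~: M)) = map (addn r) (at_pos 0%N L (pos (~: M))).
    by apply: add_rho_shift; exact: all_pos.
  have cMc : #|~: M| = b by have := cardsC M; rewrite card_ord; lia.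
  have cAc : #|~: A| = (m - p)%N by have := cardsC A; rewrite card_ord; lia.
  (* Conversely, a row [i < nk] has [la_i >= mk], so its entry is at least [mk + r = t]. *)
  have allt : all (leq t) (at_pos 0%N d (pos M)).
    apply/allP => _ /mapP[i iM ->]; have /allP/(_ i iM) /= lti := all_pos M.
    by rewrite nth_add_rho /t /N; have := hi i lti; lia.
  rewrite /term allt /H /J1 /J2 /pref UE VE at_pos_cat dM dMc -/tail.
  rewrite !size_cat !size_map size_iota -!cardE cM cMc cAc.
  have -> : inversions (pos M) (pos (~: M) ++ map (addn nk) (iota 0 r)) =
      inversions (pos M) (pos (~: M)).
    have := @inversions_join nk (pos M) (pos (~: M)) [::] (iota 0 r) (all_pos _) (all_pos _).
    by rewrite /= cats0 /inversions big_nil mul0n !addn0.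
  have vY : vdm Y' = (-1) ^+ inversions (pos A) (pos (~: A)) *
      (vdm [seq - y | y <- U] * vdm [seq - y | y <- V] * delta2 U V).
    have := @vdm_split _ (pos A) (pos (~: A)) (iota 0 m) (nth 0 Y')
      (pos_sorted _) (pos_sorted _) (iota_ltn_sorted _ _) (perm_pos A).
    rewrite -[map _ (iota 0 m)]/(at_pos 0 Y' (iota 0 m)) at_pos_iota // => ->.
    by rewrite -[map _ (_ ++ _)]/(at_pos 0 Y' _) at_pos_cat UE VE vdm_cat delta2_opp.
  have sU : size U = p by rewrite size_map -cardE.
  have sV : size V = (m - p)%N by rewrite size_map -cardE.
  have nVU : delta2 V U != 0.
    apply: delta2_neq0; rewrite uniq_catC.
    have := complement_unique (~: A) uY cA; rewrite eqxx => /andP[_ /perm_uniq ->].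
    exact: uY.
  have nTS : delta2 T S != 0 by rewrite delta2_sym mulf_neq0 ?signr_eq0.
  (* Turning the factors into the orientation of the claim costs [(-1)^(l(m-p))] and
     [(-1)^(p(m-p))]; with [(-1)^(a(m-p))] from the Laplace sign they cancel, because
     [l = a + p]. *)
  rewrite /c vY !delta2_opp (delta2_sym S V) (delta2_sym U V) sU sV size_tuple.
  rewrite intr_sign !exprD.
  have -> : (-1) ^+ (l * (m - p)) = (-1) ^+ (a * (m - p)) * (-1) ^+ (p * (m - p)) :> F.
    by rewrite -exprD -mulnDl /a (subnK lep.1).
  have := sqrr_sign F (a * (m - p)); rewrite expr2.
  move: ((-1) ^+ (a * (m - p))) => z1 z11.
  set z2 := (-1) ^+ (p * (m - p)); set x := (-1) ^+ inversions (pos A) _.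
  set y := (-1) ^+ inversions (pos M) _.
  set j1 := jacobi_trudi a _ _; set j2 := jacobi_trudi (b + r) _ _.
  set vU := vdm _; set vV := vdm _.
  transitivity ((z1 * z1) * (x * y * z2 * (delta2 T U * vU * j1) * (delta2 V S * vV * j2))).
    by ring.
  by rewrite z11; field; rewrite nVU nTS.
have pk : is_part ka.
  apply/(sortedP 0%N) => i; rewrite size_mkseq => lti.
  by rewrite !nth_mkseq //; [exact: is_part_nth | exact: ltnW].
have bka : (head 0 ka + nk <= bound)%N.
  rewrite -[head 0%N ka]nth0 /bound leq_add2r; case: (posnP nk) => n0.
    by rewrite nth_default // size_mkseq n0.
  by rewrite nth_mkseq // nth0.
congr (c * _); rewrite -(@sum_overlap _ a b nk bound ka H Eab pk (size_mkseq _ _) bka).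
have L_ge x : x \in L -> (mk <= x)%N.
  move=> /mapP[i]; rewrite mem_iota add0n => lti ->.
  by rewrite nth_mkseq // (leq_trans (hi i lti)) ?leq_addr.
have vals_le q (s : q.-tuple 'I_bound.+1) : all (leq^~ bound) (vals s).
  by apply/allP => _ /mapP[i _ ->]; rewrite /= -ltnS.
have le_ab : (a <= N)%N /\ (b <= N)%N by rewrite /N Eab -addnA !(leq_addr,
  leq_trans (leq_addr r b) (leq_addl _ _)).
apply: eq_bigr => mu pm; apply: eq_bigr => nu /andP[pn /eqP ov].
have [_ _] := (overlapP a b (vals mu) (vals nu) ka).1 ov; rewrite -Eab -/L => pe.
have mu_ge : all (leq mk) (add_rho a (vals mu)).
  by apply/allP => x xin; apply: L_ge; rewrite (perm_mem pe) mem_cat xin.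
have nu_ge : all (leq mk) (vals nu).
  apply: (part_ge_add_rho pn (size_vals nu)).
  by apply/allP => x xin; apply: L_ge; rewrite (perm_mem pe) mem_cat xin orbT.
have mu_ge' := part_ge_add_rho pm (size_vals mu) mu_ge.
rewrite /H /=; congr (_ * _ * _ * _).
  rewrite /J1 (@LS_jacobi_trudi _ _ _ _ a B) ?is_part_sub //.
  (* The padding adds [r] and the first block subtracts [t = r + mk], so the net effect is to remove
     [mk] from every part of [mu]. *)
  - rewrite -map_comp -add_rho_sub ?size_vals //; congr jacobi_trudi; apply: eq_map => x /=.
    by rewrite /t subnDl.
  - by rewrite (leq_trans (part_length_size _)) // size_map size_vals.
  - have : all (leq^~ bound) [seq (x - mk)%N | x <- vals mu].
      apply/allP => _ /mapP[x xin ->] /=.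
      by apply: leq_trans (leq_subr _ _) _; exact: (allP (vals_le _ mu)).
    move=> /sumn_le; rewrite size_map size_vals => le; rewrite /B ltnS.
    rewrite (leq_trans le) // (leq_trans (leq_mul le_ab.1 (leqnn bound))) //.
    by rewrite -!addnA leq_addr.
rewrite /J2 (@LS_jacobi_trudi _ _ _ _ (b + r) B).
- by rewrite /tail /d /N add_rho_cat ?size_vals.
- apply: (@is_part_cat_drop b); rewrite ?size_vals //.
  by apply: sub_all nu_ge => x; apply: leq_trans (lo nk (leqnn nk)).
- rewrite (leq_trans (part_length_size _)) // size_cat size_vals size_drop leq_add2l /r.
  exact: leqW (leq_trans (leq_subr _ _) (leq_addr _ _)).
- have := sumn_le (vals_le _ nu); rewrite size_vals => le.
  have led : (sumn (drop nk la) <= sumn la)%N.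
    by rewrite -[in X in (_ <= X)%N](cat_take_drop nk la) sumn_cat leq_addl.
  have := leq_mul le_ab.2 (leqnn bound) => leN.
  rewrite sumn_cat /B ltnS (leq_trans (leq_add (leq_trans le leN) led)) //.
  exact: leq_trans (leq_add (leq_addr _ _) (leqnn _)) (leq_addr _ _).
Qed.
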